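(* Let $\mathbb{K}$ be an infinite field, let $R=\mathbb{K}[x_0,\dots,x_n]$ be the standard graded polynomial ring with graded maximal ideal $\mathfrak{m}$, and let $s\ge n+1$ be an integer. Let $a$ and $b$ be positive integers such that $(b-1)s+1<a\le bs$, and put $h=bs-a+1$. Assume further that $n\ge bs-a+1$ and that $\mathcal{F}=\{f_1,\dots,f_s\}$ is a set of $(bs-a+1)$-generic $d$-forms in $R$ (where $d\ge 1$). Let $I=I_a(\mathcal{F}^b)$ be the generalized star configuration ideal, whose big height is known to be $h$. Then the following hold. (a) The symbolic powers $I^{(m)}$, $m\ge 1$, are all sequentially Cohen--Macaulay. (b) For all positive integers $k,\ell,m$, $$I^{(\ell(h+m-1)-h+k)}\subseteq \mathfrak{m}^{d((\ell-1)(h-1)+k-1)(bh-(bs-a))}\,(I^{(m)})^\ell .$$ (c) For all $\ell,m\ge 1$, $$\frac{\alpha(I^{(\ell)})}{\ell}\ \ge\ \frac{\alpha(I^{(m)})+h-1}{m+h-1}.$$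
   Context: Forms $f_1,\dots,f_s\in R$: a $d$-form is a homogeneous polynomial of degree $d$. The set $\mathcal{F}=\{f_1,\dots,f_s\}$ is called $c$-generic if any subset of $\mathcal{F}$ of size at most $c+1$ forms a regular sequence. The ideal $I_a(\mathcal{F}^b)=I_a(f_1^b\cdots f_s^b)$ is the ideal generated by all products $f_1^{n_1}\cdots f_s^{n_s}$ with $0\le n_i\le b$ for each $i$ and $\sum_i n_i=a$. For an ideal $I$ of $R$ and $m\ge 1$, the $m$-th symbolic power is $I^{(m)}=\bigcap_{\mathfrak{p}\in\operatorname{Ass}(R/I)}(I^mR_{\mathfrak{p}}\cap R)$ (all associated primes, including embedded ones). The big height of $I$ is the maximum of the heights of the associated primes of $R/I$. For a nonzero homogeneous ideal $J$, $\alpha(J)$ is the least degree of a nonzero form in $J$. A homogeneous ideal $J\subset R$ is called sequentially Cohen--Macaulay if $M=R/J$ is sequentially Cohen--Macaulay, i.e. there is a finite filtration $0=M_0\subset M_1\subset\cdots\subset M_r=M$ by graded submodules such that each $M_i/M_{i-1}$ is Cohen--Macaulay and $\dim(M_1/M_0)<\dim(M_2/M_1)<\cdots<\dim(M_r/M_{r-1})$. *)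

(* Defs.v *)
From HB Require Import structures.
From mathcomp Require Import all_boot all_order all_algebra.
From mathcomp Require Import boolp classical_sets cardinality.
From mathcomp Require Import mpoly.

Set Implicit Arguments.
Unset Strict Implicit.
Unset Printing Implicit Defensive.

Import Order.TTheory GRing.Theory Num.Theory.

Local Open Scope classical_set_scope.
Local Open Scope ring_scope.

Section Ideals.
Variable R : comNzRingType.
Implicit Types I J L N p : set R.

Definition is_ideal I : Prop :=
  [/\ I 0, (forall x y, I x -> I y -> I (x + y)) & (forall r x, I x -> I (r * x))].

Definition ideal_gen (G : set R) : set R := smallest is_ideal G.

Definition ideal_mul I J : set R :=
  ideal_gen [set z | exists x y, [/\ I x, J y & z = x * y]].

Definition ideal_exp I (m : nat) : set R := iter m (ideal_mul I) setT.

Definition is_prime p : Prop :=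
  [/\ is_ideal p, ~ p 1 & forall x y, p (x * y) -> p x \/ p y].

(* Ass(R/I): the primes that are annihilators of elements of R/I. *)
Definition ass I : set (set R) :=
  [set p | is_prime p /\ exists x, p = [set r | I (r * x)]].

(* Below, a pair of ideals L `<=` N stands for the R-module N/L.  The
   submodules of N/L are the N'/L with L `<=` N' `<=` N an ideal, and a quotient
   of two of them, (N''/L)/(N'/L), is represented by N''/N'. *)

Definition ann N L : set R := [set r | forall x, N x -> L (r * x)].

Definition prime_chain I (t : nat) : Prop :=
  exists P : nat -> set R,
    (forall i, (i <= t)%N -> is_prime (P i) /\ I `<=` P i) /\
    (forall i, (i < t)%N -> P i `<` P i.+1).

(* The module N/L has Krull dimension t; a zero module has no dimension. *)
Definition has_dim N L (t : nat) : Prop :=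
  prime_chain (ann N L) t /\
  forall t', prime_chain (ann N L) t' -> (t' <= t)%N.

(* xs is an (N/L)-regular sequence; for M = N/L, M/xM is N/(L + xN), and the
   base case says that the last quotient is nonzero. *)
Fixpoint regular_seq N L (xs : seq R) : Prop :=
  if xs is x :: xs' then
    (forall y, N y -> L (x * y) -> L y) /\
    regular_seq N [set z | exists u v, [/\ L u, N v & z = u + x * v]] xs'
  else ~ (N `<=` L).

Definition has_depth (mm : set R) N L (t : nat) : Prop :=
  (exists xs, [/\ size xs = t, (forall x, x \in xs -> mm x) & regular_seq N L xs])
  /\ forall xs, (forall x, x \in xs -> mm x) -> regular_seq N L xs ->
       (size xs <= t)%N.

Definition cohen_macaulay (mm : set R) N L : Prop :=
  exists2 t, has_dim N L t & has_depth mm N L t.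

End Ideals.

Section Symbolic.
Variable R : idomainType.
Implicit Types I p : set R.

(* The localization R_p as a subring of the fraction field. *)
Definition loc_at p : set {fraction R} :=
  [set z | exists a u : R, ~ p u /\ z = tofrac a / tofrac u].

Definition loc_ext p I : set {fraction R} :=
  [set z | exists t : seq ({fraction R} * R),
     (forall c, c \in t -> loc_at p c.1 /\ I c.2) /\
     z = \sum_(c <- t) c.1 * tofrac c.2].

Definition symb_pow I (m : nat) : set R :=
  \bigcap_(p in ass I) [set x | loc_ext p (ideal_exp I m) (tofrac x)].

End Symbolic.

Section Graded.
Variables (K : fieldType) (n : nat).
Local Notation R := {mpoly K[n]}.
Implicit Types J : set R.

Definition max_ideal : set R := ideal_gen (range (fun i : 'I_n => 'X_i : R)).

Definition homog_ideal J : Prop :=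
  is_ideal J /\ forall f e, J f -> J (pihomog mdeg e f).

(* A filtration 0 = M_0 < ... < M_r = R/J is given by the preimages F i of the
   M_i in R; M_(i+1)/M_i is then (F i.+1)/(F i).  It is nonzero, having a
   dimension, so the inclusions are strict. *)
Definition seq_cohen_macaulay J : Prop :=
  exists (r : nat) (F : nat -> set R) (e : nat -> nat),
    [/\ F 0%N = J /\ F r = setT,
        (forall i, (i <= r)%N -> homog_ideal (F i)),
        (forall i, (i < r)%N -> F i `<=` F i.+1),
        (forall i, (i < r)%N ->
           cohen_macaulay max_ideal (F i.+1) (F i) /\ has_dim (F i.+1) (F i) (e i)) &
        (forall i, (i.+1 < r)%N -> (e i < e i.+1)%N)].

Definition is_alpha J (t : nat) : Prop :=
  (exists g : R, [/\ J g, g != 0 & g \is t.-homog]) /\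
  forall t' (g : R), J g -> g != 0 -> g \is t'.-homog -> (t <= t')%N.

(* Default value 0, when J contains no nonzero form. *)
Definition alpha J : nat := xget 0%N (is_alpha J).

Definition c_generic (c s : nat) (f : 'I_s -> R) : Prop :=
  forall A : {set 'I_s}, (#|A| <= c.+1)%N ->
    regular_seq setT [set 0] [seq f i | i <- enum A].

Definition a_fold_ideal (s a b : nat) (f : 'I_s -> R) : set R :=
  ideal_gen [set g | exists k : 'I_s -> nat,
    [/\ forall i, (k i <= b)%N, (\sum_i k i)%N = a & g = \prod_i f i ^+ k i]].

End Graded.

Arguments max_ideal : clear implicits.

(* Main.v *)
(* Write mon k for the product of the f_i ^ k_i and, for a set A of indices, let the deficit
   of k on A be the sum over A of the max (m b - k_i, 0).  The m-th symbolic power of I is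
   generated by the mon k whose deficit is at most m (h - 1) on every A with at most h
   elements.  Keeping this condition only for |A| < c gives the dimension filtration.  The
   exponents that satisfy it for |A| < c but not for |A| = c fall into cells according to the
   c smallest entries of k, with ties broken by the index; added in order of decreasing
   weight, the least exponent v of each cell generates a cyclic quotient R / (f_i, i in A)
   with |A| = c.  The colon ideal is no larger than (f_i, i in A) because all previous
   generators lie in the irreducible ideal (f_i ^ (v_i + 1), i in A), and only h + 1 of the
   forms at a time are involved, so genericity is enough.

   This filtration gives the associated primes, hence the description of the symbolic
   powers.  Its strata are Cohen-Macaulay: over an infinite field linear forms extend all the
   sequences (f_i, i in A) to regular sequences of length dim R, and algebraic dependence
   modulo (f_i, i in A) bounds both depth and dimension.

   For the containment, an exponent k of the larger symbolic power is written as v + l w with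
   w obtained from the integer quotient of k by l, decreased until its deficit on some A with
   |A| = h equals m (h - 1); then v has the required degree.  Part (c) is the numerical
   shadow of this decomposition for k a multiple of a minimal exponent. *)

Require Import Defs.
From mathcomp Require Import all_boot all_order all_algebra.
From mathcomp Require Import boolp classical_sets cardinality.
From mathcomp Require Import ring mpoly zify.

Set Implicit Arguments.
Unset Strict Implicit.
Unset Printing Implicit Defensive.

Import Order.TTheory GRing.Theory Num.Theory.
Local Open Scope classical_set_scope.
Local Open Scope ring_scope.

(** * Ideals and regular sequences *)

Section IdealTheory.
Variable R : comNzRingType.
Implicit Types I J L N K P Q : set R.

(** This is the ideal that [regular_seq] passes to, named so that the two are convertible: for M =
    N/L, the module M/xM is N/[quo L N x]. *)
Definition quo L N (x : R) : set R :=
  [set z | exists u v, [/\ L u, N v & z = u + x * v]].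

Definition colon I (x : R) : set R := [set r | I (r * x)].

(** The ideal I + (xs), adjoined one element at a time so that the recursion follows that of a
    regular sequence. *)
Fixpoint ext I (xs : seq R) : set R :=
  if xs is x :: xs' then ext (quo I setT x) xs' else I.

Definition nzd I (x : R) : Prop := forall z, I (x * z) -> I z.

Lemma ideal0 I : is_ideal I -> I 0. Proof. by case. Qed.
Lemma idealD I x y : is_ideal I -> I x -> I y -> I (x + y).
Proof. by case=> _ + _; apply. Qed.
Lemma ideal_mull I r x : is_ideal I -> I x -> I (r * x).
Proof. by case=> _ _; apply. Qed.
Lemma ideal_mulr I r x : is_ideal I -> I x -> I (x * r).
Proof. by move=> idI Ix; rewrite mulrC; apply: ideal_mull. Qed.
Lemma idealN I x : is_ideal I -> I x -> I (- x).
Proof. by move=> idI Ix; rewrite -mulN1r; apply: ideal_mull. Qed.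
Lemma idealB I x y : is_ideal I -> I x -> I y -> I (x - y).
Proof. by move=> idI Ix Iy; apply: idealD => //; apply: idealN. Qed.
Lemma idealDl I x y : is_ideal I -> I x -> I (x + y) = I y.
Proof.
move=> idI Ix; apply/propext; split=> [Ixy|]; last exact: idealD.
by rewrite -(addKr x y); apply: idealD => //; apply: idealN.
Qed.
Lemma idealDr I x y : is_ideal I -> I y -> I (x + y) = I x.
Proof. by rewrite addrC; apply: idealDl. Qed.
Lemma ideal_sum I (T : Type) (r : seq T) (F : T -> R) (S : pred T) : is_ideal I ->
  (forall i, S i -> I (F i)) -> I (\sum_(i <- r | S i) F i).
Proof.
by move=> idI IF; apply: big_ind => //; [exact: ideal0|move=> x y; exact: idealD].
Qed.

Lemma ideal_setT : is_ideal (setT : set R). Proof. by []. Qed.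
Lemma ideal_zero : is_ideal ([set 0] : set R).
Proof. by split=> // [x y /= -> ->|r x /= ->]; rewrite ?addr0 ?mulr0. Qed.
Hint Resolve ideal_setT ideal_zero : core.

Lemma is_ideal_gen (G : set R) : is_ideal (ideal_gen G).
Proof.
split=> [J [idJ _]|x y Hx Hy J HJ|r x Hx J HJ]; first exact: ideal0.
- by apply: idealD (Hx J HJ) (Hy J HJ); case: HJ.
- by apply: ideal_mull (Hx J HJ); case: HJ.
Qed.

Lemma ideal_gen_min (G J : set R) : is_ideal J -> G `<=` J -> ideal_gen G `<=` J.
Proof. by move=> idJ GJ; apply: smallest_sub. Qed.
Lemma ideal_gen_sub (G : set R) : G `<=` ideal_gen G.
Proof. exact: sub_gen_smallest. Qed.

Lemma ideal_colon I x : is_ideal I -> is_ideal (colon I x).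
Proof.
move=> idI; split=> [|y z|r y] /=; rewrite /colon /=.
- by rewrite mul0r; apply: ideal0.
- by rewrite mulrDl; apply: idealD.
- by rewrite -mulrA; apply: ideal_mull.
Qed.

Lemma ideal_quo L N x : is_ideal L -> is_ideal N -> is_ideal (quo L N x).
Proof.
move=> idL idN; split.
- by exists 0, 0; split; rewrite ?mulr0 ?addr0 //; exact: ideal0.
- move=> _ _ [u [v [Lu Nv ->]]] [u' [v' [Lu' Nv' ->]]].
  exists (u + u'), (v + v'); split; [exact: idealD|exact: idealD|by rewrite mulrDr addrACA].
- move=> r _ [u [v [Lu Nv ->]]]; exists (r * u), (r * v).
  by split; [exact: ideal_mull|exact: ideal_mull|rewrite mulrDr (mulrCA r)].
Qed.

Lemma quo_subl L N x : is_ideal N -> L `<=` quo L N x.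
Proof.
by move=> idN z Lz; exists z, 0; split; rewrite ?mulr0 ?addr0 //; exact: ideal0.
Qed.
Lemma quo_gen L N x y : is_ideal L -> N y -> quo L N x (x * y).
Proof. by move=> idL Ny; exists 0, y; split; rewrite ?add0r //; exact: ideal0. Qed.
Lemma quo_mem L x : is_ideal L -> quo L setT x x.
Proof. by move=> idL; rewrite -{2}[x]mulr1; apply: quo_gen. Qed.
Lemma quo_min L N x J : is_ideal J -> L `<=` J -> (forall y, N y -> J (x * y)) ->
  quo L N x `<=` J.
Proof.
by move=> idJ LJ NJ _ [u [v [/LJ Ju /NJ Jv ->]]]; apply: idealD.
Qed.

Lemma ideal_ext I xs : is_ideal I -> is_ideal (ext I xs).
Proof.
by elim: xs I => //= x xs IH I idI; apply: IH; apply: ideal_quo.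
Qed.
Lemma ext_subl I xs : is_ideal I -> I `<=` ext I xs.
Proof.
elim: xs I => [|x xs IH] I idI z Iz //=.
by apply: IH; [exact: ideal_quo|exact: quo_subl].
Qed.
Lemma ext_mem I xs x : is_ideal I -> x \in xs -> ext I xs x.
Proof.
elim: xs I => //= y xs IH I idI; rewrite in_cons => /predU1P[->|].
  by apply: ext_subl; [exact: ideal_quo|exact: quo_mem].
by apply: IH; apply: ideal_quo.
Qed.
Lemma ext_min I xs J : is_ideal J -> I `<=` J -> (forall x, x \in xs -> J x) ->
  ext I xs `<=` J.
Proof.
move=> idJ; elim: xs I => //= x xs IH I IJ xsJ; apply: IH.
  apply: quo_min => // y _; apply: ideal_mulr => //; apply: xsJ.
  exact: mem_head.
by move=> y yxs; apply: xsJ; rewrite in_cons yxs orbT.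
Qed.
Lemma ext_sub I J xs ys : is_ideal I -> is_ideal J -> I `<=` J ->
  {subset xs <= ys} -> ext I xs `<=` ext J ys.
Proof.
move=> idI idJ IJ sub; apply: ext_min; first exact: ideal_ext.
  by apply: subset_trans IJ _; apply: ext_subl.
by move=> x /sub; apply: ext_mem.
Qed.
Lemma eq_ext I xs ys : is_ideal I -> xs =i ys -> ext I xs = ext I ys.
Proof. by move=> idI eqs; apply/seteqP; split; apply: ext_sub => // x; rewrite eqs. Qed.
Lemma ext_cat I xs ys : ext I (xs ++ ys) = ext (ext I xs) ys.
Proof. by elim: xs I => //= x xs IH I. Qed.
Lemma ext_rcons I xs x : ext I (rcons xs x) = quo (ext I xs) setT x.
Proof. by rewrite -cats1 ext_cat. Qed.

Lemma quoC I x y : is_ideal I -> quo (quo I setT x) setT y = quo (quo I setT y) setT x.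
Proof.
move=> idI; apply: (@eq_ext I [:: x; y] [:: y; x]) => // z.
by rewrite !inE orbC.
Qed.

Lemma nzdM I x y : nzd I x -> nzd I y -> nzd I (x * y).
Proof. by move=> nx ny z; rewrite -mulrA => /nx/ny. Qed.
Lemma nzdX I x e : nzd I x -> nzd I (x ^+ e).
Proof.
move=> nx; elim: e => [|e IH] z; first by rewrite mul1r.
by rewrite exprS -mulrA => /nx /IH.
Qed.

(** If xz = u + yw with u in I, then yw lies in I + (x), so w = u' + xv with u' in I; cancelling x
    puts z - yv in I. *)
Lemma nzd_swap I x y : is_ideal I -> nzd I x -> nzd I y ->
  nzd (quo I setT x) y -> nzd (quo I setT y) x.
Proof.
move=> idI nx ny nxy z [u [w [Iu _ e]]].
have [|u' [v [Iu' _ ew]]] := nxy w.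
  exists (- u), z; split => //; first exact: idealN.
  by rewrite e addrA addNr add0r.
have : I (x * (z - y * v)).
  have -> : x * (z - y * v) = u + y * u'.
    by rewrite mulrBr e ew mulrDr mulrCA addrA addrK.
  by apply: idealD => //; apply: ideal_mull.
move/nx => H; exists (z - y * v), v; split => //; by rewrite subrK.
Qed.

(** As x is a nonzerodivisor modulo I, multiplication by x embeds R/(I + (y)) in R/(I + (xy)) with
    cokernel R/(I + (x)), and g is regular on both ends. *)
Lemma nzd_quoM I x y g : is_ideal I -> nzd I x -> nzd (quo I setT x) g ->
  nzd (quo I setT y) g -> nzd (quo I setT (x * y)) g.
Proof.
move=> idI nx ngx ngy z [u [r [Iu _ e]]].
have [|u1 [z1 [Iu1 _ ez]]] := ngx z.
  by exists u, (y * r); split => //; rewrite e mulrA.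
have [|u2 [z2 [Iu2 _ ez1]]] := ngy z1.
  exists (g * z1 - y * r), r; split => //; last by rewrite subrK.
  apply: nx; have -> : x * (g * z1 - y * r) = u - g * u1.
    by have -> : u = g * z - x * y * r by [rewrite e; ring]; rewrite ez; ring.
  by apply: idealB => //; apply: ideal_mull.
exists (u1 + x * u2), z2; split => //.
  by apply: idealD => //; apply: ideal_mull.
by rewrite ez ez1 mulrDr addrA mulrA.
Qed.

Lemma colon_powS I x e z : is_ideal I -> nzd I x ->
  quo I setT (x ^+ e.+1) (x ^+ e * z) -> quo I setT x z.
Proof.
move=> idI nx [u [r [Iu _ eq]]].
exists (z - x * r), r; split => //; last by rewrite subrK.
apply: (nzdX (e := e) nx); rewrite mulrBr eq mulrA -exprSr.
by rewrite addrK.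
Qed.

(** Weak regularity also holds on zero modules, so it passes through filtrations; the nonvanishing
    in the base case of [regular_seq] is settled separately, by [lend_cyclic]. *)
Fixpoint wreg N L (xs : seq R) : Prop :=
  if xs is x :: xs' then
    (forall y, N y -> L (x * y) -> L y) /\ wreg N (quo L N x) xs'
  else True.

Fixpoint lend N L (xs : seq R) : set R :=
  if xs is x :: xs' then lend N (quo L N x) xs' else L.

Lemma regular_seqE N L xs : regular_seq N L xs <-> wreg N L xs /\ ~ N `<=` lend N L xs.
Proof.
elim: xs L => [|x xs IH] L /=; first by split=> [|[]].
split=> [[H /IH [? ?]]|[[? ?] ?]]; first by split.
by split => //; apply/IH.
Qed.

Lemma wreg_cat N L xs ys : wreg N L (xs ++ ys) <-> wreg N L xs /\ wreg N (lend N L xs) ys.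
Proof.
elim: xs L => [|x xs IH] L /=; first by split=> [|[]].
split=> [[H /IH [? ?]]|[[? ?] ?]]; first by split.
by split => //; apply/IH.
Qed.

Lemma lend_setT L xs : lend setT L xs = ext L xs.
Proof. by elim: xs L => //= x xs IH L. Qed.

Lemma wreg_rcons L xs x : wreg setT L (rcons xs x) <-> wreg setT L xs /\ nzd (ext L xs) x.
Proof.
rewrite -cats1; split=> [/wreg_cat[? /= [H _]]|[H H']].
  by split => // z; rewrite -lend_setT; exact: (H z Logic.I).
by apply/wreg_cat; split=> //=; split => // y _; rewrite lend_setT; apply: H'.
Qed.

Lemma wreg_cons L x xs : wreg setT L (x :: xs) <-> nzd L x /\ wreg setT (quo L setT x) xs.
Proof. by split=> -[H ?]; split=> // z; [exact: (H z Logic.I)|move=> _; exact: H]. Qed.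

(* Second isomorphism theorem for NK = N + K. *)
Lemma wreg_iso2 N K NK xs : is_ideal N -> is_ideal K ->
  NK = [set z | exists u v, [/\ N u, K v & z = u + v]] ->
  wreg N (N `&` K) xs -> wreg NK K xs.
Proof.
elim: xs K NK => //= x xs IH K NK idN idK eNK [H1 H2]; split.
  move=> y; rewrite eNK => -[u [v [Nu Kv ->]]].
  rewrite mulrDr (idealDr _ idK (ideal_mull x idK Kv)).
  move=> Kxu; apply: idealD => //.
  by have [] := H1 u Nu; [split => //; apply: ideal_mull|].
have idNK : is_ideal NK.
  rewrite eNK; split.
  - by exists 0, 0; rewrite addr0; split => //; apply: ideal0.
  - move=> _ _ [u [v [Nu Kv ->]]] [u' [v' [Nu' Kv' ->]]].
    by exists (u + u'), (v + v'); rewrite addrACA; split => //; apply: idealD.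
  - move=> r _ [u [v [Nu Kv ->]]].
    by exists (r * u), (r * v); rewrite mulrDr; split => //; apply: ideal_mull.
apply: IH => //; first exact: ideal_quo.
  rewrite eNK; apply/seteqP; split=> _ [u [v [Nu Kv ->]]].
    by exists u, v; split=> //; apply: quo_subl => //; rewrite -eNK.
  case: Kv => [k [_ [Kk [u' [v' [Nu' Kv' ->]]] ->]]].
  exists (u + x * u'), (k + x * v'); split.
  - by apply: idealD => //; apply: ideal_mull.
  - by apply: idealD => //; apply: ideal_mull.
  - by rewrite mulrDr addrA addrACA !addrA.
have -> // : N `&` quo K NK x = quo (N `&` K) N x.
rewrite eNK; apply/seteqP; split.
  move=> z [Nz [k [_ [Kk [u' [v' [Nu' Kv' ->]]] ez]]]].
  move: Nz; rewrite ez => Nz.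
  exists (k + x * v'), u'; split => //; last by rewrite mulrDr addrA addrAC.
  split; last by apply: idealD => //; apply: ideal_mull.
  by move: Nz; rewrite mulrDr addrCA (idealDl _ idN (ideal_mull x idN Nu')).
move=> _ [u [v [[Nu Ku] Nv ->]]]; split.
  by apply: idealD => //; apply: ideal_mull.
exists u, v; split => //; exists v, 0; rewrite addr0; split => //; exact: ideal0.
Qed.

(** Consider 0 -> N/L -> N'/L -> N'/N -> 0: since the first element x is regular on N'/N, the
    sequence stays exact modulo x. *)
Lemma wreg_extension N' N L xs : is_ideal N' -> is_ideal N -> is_ideal L ->
  L `<=` N -> N `<=` N' -> wreg N L xs -> wreg N' N xs -> wreg N' L xs.
Proof.
elim: xs N L => //= x xs IH N L idN' idN idL LN NN' [H1 H2] [H3 H4]; split.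
  by move=> y N'y Lxy; apply: H1 => //; apply: H3 => //; apply: LN.
apply: (IH (quo N N' x)) => //; try exact: ideal_quo.
- by apply: quo_min; [exact: ideal_quo|apply: subset_trans LN _; exact: quo_subl|
    move=> y N'y; apply: quo_gen].
- by apply: quo_min => // y N'y; apply: ideal_mull.
(* The submodule modulo x is (N + xN')/(L + xN'); it is N/(L + xN) because N meets L + xN' in L +
   xN. *)
apply: (@wreg_iso2 N) => //; first exact: ideal_quo.
  apply/seteqP; split.
    move=> _ [u [v [Nu N'v ->]]]; exists u, (x * v); split => //; exact: quo_gen.
  move=> _ [u [_ [Nu [l [v [Ll N'v ->]]] ->]]].
  by exists (u + l), v; rewrite addrA; split => //; apply: idealD => //; apply: LN.
have -> // : N `&` quo L N' x = quo L N x.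
apply/seteqP; split.
  move=> z [Nz [l [v [Ll N'v ez]]]]; move: Nz; rewrite ez.
  by rewrite (idealDl _ idN (LN _ Ll)) => /(H3 v N'v) Nv; exists l, v.
move=> _ [l [v [Ll Nv ->]]]; split.
  by apply: idealD; [|exact: LN|exact: ideal_mull].
by exists l, v; split => //; apply: NN'.
Qed.

(** Multiplication by u identifies R/P with (L + (u))/L; the induction passes to L + x(L + (u)),
    whose colon by u is P + (x). *)
Lemma wreg_cyclic L P u xs : is_ideal L -> colon L u = P ->
  wreg setT P xs -> wreg (quo L setT u) L xs.
Proof.
elim: xs L P => //= x xs IH L P idL eP [H1 H2]; split.
  move=> _ [l [r [Ll _ ->]]]; rewrite mulrDr (idealDl _ idL (ideal_mull x idL Ll)).
  move=> Lxur; apply: idealD => //; rewrite mulrC.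
  suff: colon L u r by []. 
  by rewrite eP; apply: H1 => //; rewrite -eP /colon /= mulrAC -mulrA.
set N := quo L setT u.
have idN : is_ideal N by apply: ideal_quo.
set L1 := quo L N x.
have idL1 : is_ideal L1 by apply: ideal_quo.
have -> : N = quo L1 setT u.
  apply/seteqP; split; first by apply: quo_min; [exact: ideal_quo|
    apply: subset_trans (quo_subl _ _) (quo_subl _ _)|
    move=> y _; apply: quo_gen].
  apply: quo_min => //; last by move=> y _; apply: quo_gen.
  by apply: quo_min => //; [exact: quo_subl|move=> y Ny; apply: ideal_mull].
apply: IH H2 => //; apply/seteqP; split.
  move=> r [l [_ [Ll [l' [r' [Ll' _ ->]]] e]]].
  exists (r - x * r'), r'; split => //; last by rewrite subrK.
  rewrite -eP /colon /=.
  have -> : (r - x * r') * u = l + x * l'.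
    by rewrite mulrBl e mulrDr addrA -mulrA (mulrC r') addrK.
  by apply: idealD => //; apply: ideal_mull.
move=> _ [p [v [Pp _ ->]]]; exists (p * u), (u * v); split.
- by have : colon L u p by rewrite eP.
- exact: quo_gen.
- by rewrite mulrDl -mulrA (mulrC v).
Qed.

End IdealTheory.
#[global] Hint Resolve ideal_setT ideal_zero : core.

(** * Graded ideals *)

Section GradedIdeals.
Variables (K : fieldType) (n : nat).
Local Notation R := {mpoly K[n]}.
Implicit Types (I J Q : set R) (x y z : R).

Definition posform x : Prop := exists2 d, (0 < d)%N & x \is d.-homog.

Lemma pihomogMl d e x r : x \is d.-homog ->
  pihomog mdeg e (x * r) = if (d <= e)%N then x * pihomog mdeg (e - d) r else 0.
Proof.
move=> hx; rewrite {1}(pihomog_partitionE (leqnn (msize r))) mulr_sumr raddf_sum /=.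
have piE (i : nat) : pihomog mdeg e (x * pihomog mdeg i r) =
    if (d + i == e)%N then x * pihomog mdeg i r else 0.
  have h := dhomogM hx (pihomogP mdeg i r).
  case: eqP => [<-|/eqP ne]; first by rewrite pihomog_dE.
  exact: pihomog_ne0 ne h.
under eq_bigr do rewrite piE.
case: leqP => [le_de|lt_ed]; last first.
  by rewrite big1 // => i _; case: eqP => // ei; move: lt_ed; rewrite -ei ltnNge leq_addr.
case: (ltnP (e - d) (msize r)) => [lt|ge].
  rewrite (bigD1 (Ordinal lt)) //= subnKC // eqxx big1 ?addr0 // => i ne.
  case: eqP => // ei; case/eqP: ne; apply: val_inj => /=; lia.
rewrite big1 => [|i _]; last first.
  by case: eqP => // ei; have := ltn_ord i; lia.
rewrite (_ : pihomog _ _ _ = 0) ?mulr0 //.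
apply/mpolyP => m; rewrite mcoeff0.
have := pihomogP mdeg (e - d) r => /dhomog_nemf_coeff hm.
have [em|/hm //] := eqVneq (mdeg m) (e - d)%N.
rewrite pihomogE.
rewrite big1_seq ?mcoeff0 // => k /andP[/eqP ek kr].
have := msize_mdeg_lt kr; rewrite ek; lia.
Qed.

Lemma homog_ideal_quo Q x d : homog_ideal Q -> x \is d.-homog ->
  homog_ideal (quo Q setT x).
Proof.
move=> [idQ hQ] hx; split; first exact: ideal_quo.
move=> _ e [u [v [Qu _ ->]]]; rewrite raddfD /= (pihomogMl _ _ hx).
case: leqP => _; last by rewrite addr0; apply: quo_subl => //; apply: hQ.
by exists (pihomog mdeg e u), (pihomog mdeg (e - d) v); split => //; apply: hQ.
Qed.

Lemma homog_ideal_ext Q xs : homog_ideal Q -> (forall x, x \in xs -> posform x) ->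
  homog_ideal (ext Q xs).
Proof.
elim: xs Q => //= x xs IH Q hQ hxs; apply: IH.
  have [d _ hx] := hxs x (mem_head _ _); exact: homog_ideal_quo hx.
by move=> y yxs; apply: hxs; rewrite in_cons yxs orbT.
Qed.

Lemma homog_ideal_zero : homog_ideal ([set 0] : set R).
Proof. by split=> // f e /= ->; rewrite raddf0. Qed.

Lemma homog_ideal_gen (G : set R) : (forall g, G g -> exists d, g \is d.-homog) ->
  homog_ideal (ideal_gen G).
Proof.
move=> hG; split; first exact: is_ideal_gen.
suff : ideal_gen G `<=` [set g | forall e, ideal_gen G (pihomog mdeg e g)].
  by move=> H f e /H.
have idG := is_ideal_gen G.
apply: ideal_gen_min; first split.
- by move=> e; rewrite raddf0; exact: ideal0 idG.
- by move=> x y /= Hx Hy e; rewrite raddfD /=; exact: idealD idG (Hx e) (Hy e).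
- move=> r x /= Hx e.
  rewrite (pihomog_partitionE (leqnn (msize x))) mulr_sumr raddf_sum /=.
  apply: ideal_sum => // i _; rewrite mulrC (pihomogMl _ _ (pihomogP _ _ _)).
  by case: leqP => _; [exact: ideal_mulr idG (Hx _)|exact: ideal0 idG].
- move=> g Gg e; have [d hg] := hG g Gg.
  have [->|ne] := eqVneq e d; first by rewrite pihomog_dE //; apply: ideal_gen_sub.
  by rewrite (pihomog_ne0 _ hg) 1?eq_sym //; exact: ideal0 idG.
Qed.

(* Graded Nakayama: (Q : y) is x times itself modulo Q, and x has positive degree. *)
Lemma nzd_graded_swap Q x y : homog_ideal Q -> posform x -> posform y ->
  nzd Q x -> nzd (quo Q setT x) y -> nzd Q y.
Proof.
move=> [idQ hQ] [dx dx0 hx] [dy _ hy] nx ny.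
have key e z : z \is e.-homog -> Q (y * z) -> Q z.
  elim/ltn_ind: e z => e IH z hz Qyz.
  have [|u [v [Qu _ ez]]] := ny z; first exact: quo_subl.
  have : z = pihomog mdeg e z by rewrite pihomog_dE.
  rewrite ez raddfD /= (pihomogMl _ _ hx) -ez.
  case: leqP => [le_dx|_] -> ; last by rewrite addr0; apply: hQ.
  apply: idealD => //; first exact: hQ.
  apply: ideal_mull => //; apply: (IH (e - dx)%N); [lia|exact: pihomogP|].
  apply: nx; have := hQ _ (dy + e)%N Qyz; rewrite (pihomogMl _ _ hy) leq_addr addKn.
  rewrite [in pihomog _ _ z]ez raddfD /= (pihomogMl _ _ hx) le_dx mulrDr.
  rewrite (idealDl _ idQ); first by rewrite mulrCA.
  by apply: ideal_mull => //; apply: hQ.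
move=> z Qyz; rewrite (pihomog_partitionE (leqnn (msize z))); apply: ideal_sum => // i _.
apply: (key i); first exact: pihomogP.
by have := hQ _ (dy + i)%N Qyz; rewrite (pihomogMl _ _ hy) leq_addr addKn.
Qed.

Lemma wreg_swap Q x y xs : homog_ideal Q -> posform x -> posform y ->
  wreg setT Q (x :: y :: xs) -> wreg setT Q (y :: x :: xs).
Proof.
move=> hQ px py /wreg_cons[nx /wreg_cons[ny H]].
have ny' := nzd_graded_swap hQ px py nx ny.
apply/wreg_cons; split => //; apply/wreg_cons; split.
  by case: hQ => idQ _; apply: nzd_swap.
by rewrite quoC //; case: hQ.
Qed.

Lemma wreg_rot Q x xs : homog_ideal Q -> posform x -> (forall y, y \in xs -> posform y) ->
  wreg setT Q (x :: xs) <-> wreg setT Q (rcons xs x).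
Proof.
elim: xs Q => //= y xs IH Q hQ px pxs.
have py : posform y by apply: pxs; apply: mem_head.
have pxs' z : z \in xs -> posform z by move=> zxs; apply: pxs; rewrite in_cons zxs orbT.
have [dx _ hx] := px; have [dy _ hy] := py.
have hQy := homog_ideal_quo hQ hy.
have {}IH := IH _ hQy px pxs'; split.
  by move=> /(wreg_swap hQ px py)/wreg_cons[ny /IH H]; split => // z _; apply: ny.
move=> H; apply: (wreg_swap hQ py px).
by case: H => H /IH; split.
Qed.

End GradedIdeals.

(** * Noetherianity and avoidance *)

Section Dickson.

(** Each [g N] is a position from N on where f attains its minimum on that tail; restarting just
    past the last choice gives the subsequence. *)
Lemma nondecreasing_subsequence (f : nat -> nat) : exists phi : nat -> nat,
  {homo phi : i j / (i < j)%N} /\ {homo (f \o phi) : i j / (i <= j)%N}.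
Proof.
have /choice[g gP] : forall N, exists i, (N <= i)%N /\ forall j, (N <= j)%N -> (f i <= f j)%N.
  move=> N; have ex : exists v, `[< exists2 i, (N <= i)%N & f i = v >].
    by exists (f N); apply/asboolP; exists N.
  case: (ex_minnP ex) => v /asboolP[i Ni <-] vmin; exists i; split => // j Nj.
  by apply: vmin; apply/asboolP; exists j.
pose phi i := iter i (fun k => g k.+1) (g 0%N).
have phiS i : (phi i < phi i.+1)%N by have [] := gP (phi i).+1.
exists phi; split; first by apply: homo_ltn => // ? ? ?; apply: ltn_trans.
apply: homo_leq => [//|? ? ?|i] /=; first exact: leq_trans.
case: i => [|i]; first by have [_] := gP 0%N; apply.
have [_] := gP (phi i).+1; apply; apply: leq_trans (phiS i.+1); exact: ltnW (phiS i).
Qed.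

(** Nondecreasing subsequences are extracted for one coordinate after another. *)
Lemma dickson n (m : nat -> 'X_{1..n}) : exists i j, (i < j)%N /\ (m i <= m j)%MM.
Proof.
have [phi [phi_lt phi_le]] : exists phi : nat -> nat, {homo phi : i j / (i < j)%N} /\
    forall c, c \in enum 'I_n -> {homo (fun i => m (phi i) c) : i j / (i <= j)%N}.
  elim: (enum 'I_n) => [|c s [phi [phi_lt phi_le]]]; first by exists id; split.
  have [psi [psi_lt psi_le]] := nondecreasing_subsequence (fun i => m (phi i) c).
  exists (phi \o psi); split; first by move=> i j /psi_lt/phi_lt.
  move=> c'; rewrite in_cons => /predU1P[->|c's] i j ij; first exact: (psi_le i j).
  apply: (phi_le c' c's); move: ij; rewrite leq_eqVlt => /orP[/eqP->|/psi_lt/ltnW] //.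
exists (phi 0%N), (phi 1%N); split; first exact: phi_lt.
by apply/mnm_lepP => c; apply: phi_le => //; rewrite mem_enum.
Qed.

End Dickson.

Section Noetherian.
Variables (K : fieldType) (n : nat).
Local Notation R := {mpoly K[n]}.
Implicit Types (I J Q p : set R) (x y z : R).

Lemma min_mlead (S : set R) : S !=set0 ->
  exists2 g, S g & forall q, S q -> ~~ (mlead q < mlead g)%O.
Proof.
move=> [g0 Sg0]; apply: contrapT => H.
suff : forall g, ~ S g by move/(_ g0).
apply: mleadrect => g IH Sg; apply: H; exists g => // q Sq.
by apply/negP => /IH.
Qed.


Lemma mlead_reduce x y : x != 0 -> y != 0 -> (mlead x <= mlead y)%MM ->
  exists r, y - r * x = 0 \/ (mlead (y - r * x) < mlead y)%O.
Proof.
move=> x0 y0 le; pose c := mleadc y / mleadc x.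
have cx : mleadc x != 0 by rewrite mleadc_eq0.
have c0 : c != 0 by rewrite mulf_neq0 ?invr_eq0 // mleadc_eq0.
pose m := (mlead y - mlead x)%MM; exists (c *: 'X_[m]).
have X0 : 'X_[m] != 0 :> R.
  by apply/eqP => /(congr1 (mcoeff m)) /eqP; rewrite mcoeffX eqxx mcoeff0 oner_eq0.
have lrx : mlead (c *: 'X_[m] * x) = mlead y.
  by rewrite -scalerAl mleadZ // mleadM // mleadXm submK.
have [e0|ne0] := eqVneq (y - c *: 'X_[m] * x) 0; [by left|right].
rewrite lt_neqAle; apply/andP; split; last first.
  by apply: le_trans (mleadB_le _ _) _; rewrite lrx joinxx.
apply: contra ne0 => /eqP e; rewrite -mleadc_eq0 e mcoeffB -scalerAl mcoeffZ.
have -> : ('X_[m] * x)@_(mlead y) = mleadc x.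
  rewrite -(submK le) -/m; have := mleadcM 'X_[m] x.
  by rewrite mleadXm mcoeffX eqxx mul1r.
by rewrite /c divfK // subrr.
Qed.

(** Noetherianity. In a strictly increasing chain, take g_i of minimal leading monomial in the i-th
    difference; by Dickson some g_j is reducible by an earlier g_i, against minimality. *)
Lemma ideal_maximal (S : set (set R)) : S !=set0 -> (forall I, S I -> is_ideal I) ->
  exists2 I, S I & forall J, S J -> I `<=` J -> J `<=` I.
Proof.
move=> [I0 SI0] idS; apply: contrapT => H.
have /choice[nx nxP] : forall I, exists J, S I ->
    [/\ S J, I `<=` J & exists2 x, J x & ~ I x].
  move=> I; have [SI|] := pselect (S I); last by exists I.
  apply: contrapT => H'; apply: H; exists I => // J SJ IJ x Jx.
  by apply: contrapT => nIx; apply: H'; exists J => _; split => //; exists x.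
pose c i := iter i nx I0.
have Sc i : S (c i) by elim: i => // i IH; have [] := nxP _ IH.
have cS i : c i `<=` c i.+1 by have [] := nxP _ (Sc i).
have c_le i j : (i <= j)%N -> c i `<=` c j.
  move=> ij; apply: (homo_leq (r := fun A B => A `<=` B) _ _ cS ij) => [A z //|A B C].
  exact: subset_trans.
have /choice[g gP] : forall i, exists g, [/\ c i.+1 g, ~ c i g &
    forall q, c i.+1 q -> ~ c i q -> ~~ (mlead q < mlead g)%O].
  move=> i; have [_ _ [x c1x c0x]] := nxP _ (Sc i).
  have [|g [c1g c0g] gmin] := @min_mlead [set z | c i.+1 z /\ ~ c i z]; first by exists x.
  by exists g; split => // q c1q c0q; apply: gmin.
have g0 i : g i != 0.
  apply/eqP => e; have [_] := gP i; rewrite e => + _; apply.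
  exact: ideal0 (idS _ (Sc i)).
have [i [j [ij le]]] := dickson (fun i => mlead (g i)).
have [r hr] := mlead_reduce (g0 i) (g0 j) le.
have [cj1 cj cmin] := gP j; have [ci1 _ _] := gP i.
have cjgi : c j (r * g i) by apply: ideal_mull (idS _ (Sc j)) _; exact: c_le ci1.
have ncj : ~ c j (g j - r * g i).
  by move=> h; apply: cj; rewrite -(subrK (r * g i) (g j)); exact: idealD (idS _ (Sc j)) h cjgi.
case: hr => [e0|]; first by apply: ncj; rewrite e0; exact: ideal0 (idS _ (Sc j)).
by apply/negP; apply: cmin => //; apply: idealB (idS _ (Sc j.+1)) _ _ => //; exact: cS.
Qed.

Lemma colon_max_prime Q y : is_ideal Q -> ~ Q y ->
  (forall r, ~ Q (r * y) -> colon Q (r * y) `<=` colon Q y) -> is_prime (colon Q y).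
Proof.
move=> idQ nQy ymax; split; first exact: ideal_colon.
  by rewrite /colon /= mul1r.
move=> a b; rewrite /colon /= => Qaby.
have [Qby|nQby] := pselect (Q (b * y)); [by right|left].
by apply: (ymax b) => //; rewrite /colon /= mulrA.
Qed.

Lemma exists_associated_prime Q x : is_ideal Q -> ~ Q x ->
  exists2 r, ~ Q (r * x) & is_prime (colon Q (r * x)).
Proof.
move=> idQ nQx.
pose S := [set I | exists2 r, ~ Q (r * x) & I = colon Q (r * x)].
have [||I [r nQr ->] rmax] := @ideal_maximal S.
- by exists (colon Q x), 1; rewrite mul1r.
- by move=> _ [r _ ->]; apply: ideal_colon.
exists r => //; apply: colon_max_prime => // t nQt; apply: rmax.
  by exists (t * r); rewrite -?mulrA.
by move=> a; rewrite /colon /= => Qa; rewrite mulrCA; apply: ideal_mull.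
Qed.

(** The zero divisors lie in finitely many primes: ys is chosen to make Q + (ys) maximal among the
    ideals generated over Q by finitely many elements whose annihilators modulo Q are maximal. *)
Lemma zero_divisors_primes Q : is_ideal Q -> exists ys : seq R,
  (forall y, y \in ys -> ~ Q y /\ is_prime (colon Q y)) /\
  forall x, ~ nzd Q x -> exists2 y, y \in ys & colon Q y x.
Proof.
move=> idQ.
pose maxcol y := ~ Q y /\
  forall y', ~ Q y' -> colon Q y `<=` colon Q y' -> colon Q y' `<=` colon Q y.
have maxcol_prime y : maxcol y -> is_prime (colon Q y).
  move=> [nQy ymax]; apply: colon_max_prime => // r nQr; apply: ymax => // a.
  by rewrite /colon /= => Qa; rewrite mulrCA; apply: ideal_mull.
pose S := [set I | exists2 ys : seq R, (forall y, y \in ys -> maxcol y) & I = ext Q ys].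
have [||I [ys ysmax ->] Imax] := @ideal_maximal S.
- by exists Q, [::].
- by move=> _ [ys _ ->]; apply: ideal_ext.
exists ys; split; first by move=> y /ysmax my; split; [case: my|exact: maxcol_prime].
move=> x nx.
have [z Qxz nQz] : exists2 z, Q (x * z) & ~ Q z.
  apply: contrapT => H; apply: nx => z Qxz; apply: contrapT => nQz; apply: H; by exists z.
pose S' := [set I | exists y, [/\ ~ Q y, colon Q z `<=` colon Q y & I = colon Q y]].
have [||_ [y [nQy zy ->]] ymax] := @ideal_maximal S'.
- by exists (colon Q z), z; split => // ?.
- by move=> _ [y [_ _ ->]]; apply: ideal_colon.
have my : maxcol y.
  split => // y' nQy' yy'; apply: ymax => //; exists y'; split => //.
  exact: subset_trans zy yy'.
have Qyx : colon Q y x by apply: zy.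
have py := maxcol_prime _ my.
have yI : ext Q ys y.
  apply: (Imax (ext Q (rcons ys y))).
  - exists (rcons ys y) => // t; rewrite mem_rcons in_cons => /predU1P[->//|].
    exact: ysmax.
  - by apply: ext_sub => // t; rewrite mem_rcons in_cons => ->; rewrite orbT.
  - by apply: ext_mem => //; rewrite mem_rcons mem_head.
apply: contrapT => H.
(* Without such an a, maximality would give Q : t = Q : y, which contains x. The product of the a
   for all t then kills Q + (ys), hence y, modulo Q, though no factor lies in the prime Q : y. *)
have Hy t : t \in ys -> exists2 a, Q (a * t) & ~ colon Q y a.
  move=> tys; apply: contrapT => H'; apply: H; exists t => //.
  have [_ tmax] := ysmax t tys.
  apply: (tmax y nQy) => // a Qat; apply: contrapT => nya.
  by apply: H'; exists a.
have [a aP na] : exists2 a, forall t, t \in ys -> Q (a * t) & ~ colon Q y a.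
  elim: (ys) Hy => [|t ts IH] Hy; first by exists 1 => //; rewrite /colon /= mul1r.
  have [t' t'ts|a aP na] := IH; first by apply: Hy; rewrite in_cons t'ts orbT.
  have [b Qb nb] := Hy t (mem_head _ _).
  exists (b * a); last by case: py => _ _ /[apply] -[].
  move=> t'; rewrite in_cons => /predU1P[->|/aP Qat'].
    by rewrite mulrAC; apply: ideal_mulr.
  by rewrite -mulrA; apply: ideal_mull.
apply: na; rewrite /colon /=.
have idC : is_ideal [set w | Q (a * w)].
  have [h1 h2 h3] := ideal_colon a idQ.
  split=> /= [|u v|r u]; rewrite ![a * _]mulrC; [exact: h1|exact: h2|exact: h3].
apply: (ext_min idC _ aP yI) => w Qw /=; exact: ideal_mull.
Qed.

(* A prime q inside p avoiding l: the ideals disjoint from the multiplicative set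
   generated by l and the complement of p have maximal elements, which are prime. *)
Lemma prime_avoiding Q p l : is_ideal Q -> is_prime p -> Q `<=` p -> nzd Q l ->
  exists q, [/\ is_prime q, Q `<=` q, q `<=` p & ~ q l].
Proof.
move=> idQ [idp p1 pM] Qp nl.
pose S := [set I | [/\ is_ideal I, Q `<=` I &
  forall k v, I (l ^+ k * v) -> p v]].
have [||I [idI QI Idisj] Imax] := @ideal_maximal S.
- by exists Q; split => // k v /(nzdX (e := k) nl) /Qp.
- by move=> I [].
have I1 : forall k v, I (l ^+ k * v) -> p v by [].
exists I; split => //; last first.
- by move=> Il; apply: p1; apply: (I1 1%N); rewrite expr1 mulr1.
- by move=> v Iv; apply: (I1 0%N); rewrite expr0 mul1r.
split => //; first by move=> I1'; apply: p1; apply: (I1 0%N); rewrite expr0 mul1r.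
move=> a b Iab.
have out c : ~ I c -> exists k v r, I (l ^+ k * v - c * r) /\ ~ p v.
  move=> nIc; apply: contrapT => H; apply: nIc.
  apply: (Imax (quo I setT c)); last exact: quo_mem.
    split; first exact: ideal_quo.
      by apply: subset_trans QI _; apply: quo_subl.
    move=> k v [u [r [Iu _ e]]]; apply: contrapT => npv; apply: H.
    by exists k, v, r; rewrite e addrK.
  exact: quo_subl.
have [|/out[k [v [r [Ikv nv]]]]] := pselect (I a); first by left.
have [|/out[k' [v' [r' [Ikv' nv']]]]] := pselect (I b); first by right.
suff /I1 /pM[] : I (l ^+ (k + k') * (v * v')) by [].
have -> : l ^+ (k + k') * (v * v') =
    (l ^+ k * v - a * r) * (l ^+ k' * v') + (l ^+ k' * v' - b * r') * (a * r) +
    (a * b) * (r * r') by rewrite exprD; ring.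
by apply: idealD => //; [apply: idealD => //|]; apply: ideal_mulr.
Qed.

Definition linear_form (v : 'I_n -> K) : R := \sum_i v i *: 'X_i.

Lemma linear_form_homog v : linear_form v \is 1.-homog.
Proof. by apply: rpred_sum => i _; apply: rpredZ; rewrite dhomogX; apply/eqP; exact: mdeg1. Qed.

Lemma infinite_set_seq (T : choiceType) (A : set T) N : infinite_set A ->
  exists s : seq T, [/\ uniq s, size s = N & forall t : T, t \in s -> A t].
Proof.
move=> infA; elim: N => [|N [s [us ss sA]]]; first by exists [::].
have /infinite_setN0[x [Ax /= xs]] := infinite_setD infA (finite_seq s).
exists (x :: s); split; rewrite /= ?ss ?us ?andbT //; first by apply/negP.
by move=> y; rewrite in_cons => /predU1P[->//|/sA].
Qed.

(* By Vandermonde, any n of these forms span all linear forms. *)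
Definition moment_form (t : K) : R := linear_form (fun i => t ^+ i).

(** If p contained infinitely many of these forms, inverting the Vandermonde matrix of n of them
    would put every variable in p. *)
Lemma finite_moment_forms p : is_ideal p -> ~ (forall i : 'I_n, p 'X_i) ->
  finite_set [set t | p (moment_form t)].
Proof.
move=> idp; apply: contra_notP => /(infinite_set_seq n)[s [us ss sp]] k.
pose a : 'rV[K]_n := \row_j s`_j; pose V := Vandermonde n a.
have Vu : V \in unitmx.
  rewrite unitmxE unitfE det_Vandermonde; apply/prodf_neq0 => i _.
  apply/prodf_neq0 => j ij; rewrite !mxE subr_eq0 nth_uniq ?ss //.
  by rewrite neq_ltn ij orbT.
have -> : 'X_k = \sum_j (invmx V j k) *: moment_form (a 0 j).
  transitivity (\sum_i (V *m invmx V) i k *: 'X_i : R).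
    rewrite mulmxV // (bigD1 k) //= big1 => [|i /negPf ik]; rewrite mxE ?ik ?scale0r //.
    by rewrite eqxx scale1r addr0.
  under [RHS]eq_bigr do rewrite /moment_form /linear_form scaler_sumr.
  rewrite exchange_big; apply: eq_bigr => i _; rewrite mxE scaler_suml.
  by apply: eq_bigr => j _; rewrite scalerA mulrC !mxE.
apply: ideal_sum => // j _; rewrite -mul_mpolyC; apply: ideal_mull => //.
by apply: sp; rewrite mxE mem_nth // ss.
Qed.

(** For an ideal Q this says that [max_ideal] is not an associated prime of R/Q. *)
Definition no_socle Q : Prop := forall z, (forall i : 'I_n, Q ('X_i * z)) -> Q z.

(** The zero divisors of each Q i lie in finitely many primes, none containing all variables, so
    each Q i excludes finitely many parameters t of the moment forms; an infinite field leaves one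
    over. *)
Lemma linear_nonzerodivisor (T : finType) (Q : T -> set R) :
  infinite_set [set: K] -> (forall i, is_ideal (Q i)) -> (forall i, no_socle (Q i)) ->
  exists2 l : R, l \is 1.-homog & forall i, nzd (Q i) l.
Proof.
move=> infK idQ nsQ.
have fin i : finite_set [set t | ~ nzd (Q i) (moment_form t)].
  have [ys [ysP zd]] := zero_divisors_primes (idQ i).
  apply: sub_finite_set (_ : _ `<=` \bigcup_(y in [set` ys])
      [set t | colon (Q i) y (moment_form t)]) _.
    by move=> t /= /zd[y yys Hy]; exists y.
  apply: bigcup_finite => [|y yys]; first exact: finite_seq.
  have [nQy [idp _ _]] := ysP y yys.
  by apply: finite_moment_forms => // H; apply: nQy; apply: nsQ.
have /(infinite_setD infK)/infinite_setN0[t [_ /= tP]] :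
    finite_set (\bigcup_(i in [set: T]) [set t | ~ nzd (Q i) (moment_form t)]).
  by apply: bigcup_finite => // ; apply: finite_finset.
exists (moment_form t); first exact: linear_form_homog.
by move=> i; apply: contrapT => H; apply: tP; exists i.
Qed.

End Noetherian.

(** * Algebraic relations and dimension *)

Section AlgebraicRelations.
Variables (K : fieldType) (n : nat).
Local Notation R := {mpoly K[n]}.
Implicit Types (I J L N Q p : set R) (x y z g : R) (xs : seq R).

(* What is left of a nonzero polynomial expression g in xs over K when one only remembers
   its lexicographically lowest monomial.  If g annihilates N/L, then xs is neither
   (N/L)-regular nor a transversal of a chain of primes above ann N L; this bounds both
   depth and dimension. *)
Fixpoint lowest_term xs g : Prop :=
  if xs is x :: xs' then
    exists k g' r, lowest_term xs' g' /\ g = x ^+ k * (g' + x * r)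
  else exists2 c : K, c != 0 & g = c%:MP.

Lemma lowest_term1 xs : lowest_term xs 1.
Proof.
elim: xs => [|x xs IH] /=; first by exists 1; rewrite ?oner_eq0 ?mpolyC1.
by exists 0%N, 1, 0; rewrite mulr0 addr0 mul1r.
Qed.

Lemma lowest_termM xs g g' : lowest_term xs g -> lowest_term xs g' ->
  lowest_term xs (g * g').
Proof.
elim: xs g g' => [|x xs IH] g g' /=.
  move=> [c c0 ->] [c' c'0 ->]; exists (c * c'); first exact: mulf_neq0.
  by rewrite mpolyCM.
move=> [k [h [r [Hh ->]]]] [k' [h' [r' [Hh' ->]]]].
exists (k + k')%N, (h * h'), (h * r' + r * (h' + x * r')).
by split; [exact: IH|rewrite exprD; ring].
Qed.

(** If y^k (g' + y r) lies in I, the power of the nonzerodivisor y cancels and g' lies in I +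
    (y). *)
Lemma lowest_term_ext xs ys I : is_ideal I -> wreg setT I ys ->
  forall g, I g -> lowest_term (ys ++ xs) g -> exists2 g', ext I ys g' & lowest_term xs g'.
Proof.
elim: ys I => [|y ys IH] I idI /=; first by move=> _ g Ig lg; exists g.
move=> [ny reg] g Ig [k [g' [r [lg' eg]]]].
apply: (IH _ _ reg g') => //; first exact: ideal_quo.
exists (g' + y * r), (- r); split => //; last by rewrite mulrN addrK.
by apply: (@nzdX _ I y k); [move=> z; apply: ny|rewrite -eg].
Qed.

Lemma lowest_term_regular N L xs g : is_ideal N -> is_ideal L -> L `<=` N ->
  regular_seq N L xs -> ann N L g -> ~ lowest_term xs g.
Proof.
elim: xs L g => [|x xs IH] L g idN idL LN /=.
  move=> nNL Ag [c c0 eg]; apply: nNL => y Ny.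
  have := Ag y Ny; rewrite eg => Lcy.
  by rewrite -[y]mul1r -mpolyC1 -(mulVf c0) mpolyCM -mulrA; apply: ideal_mull.
move=> [nx reg] Ag [k [g' [r [lg' eg]]]].
apply: (IH _ g' idN _ _ reg _ lg'); first exact: ideal_quo.
  by apply: subset_trans _ (_ : N `<=` N) => //; apply: quo_min => // y; apply: ideal_mull.
move=> y Ny /=.
exists ((g' + x * r) * y), (- r * y); split; last by ring.
- suff nxk e z : N z -> L (x ^+ e * z) -> L z.
    by apply: (nxk k); [exact: ideal_mull|rewrite mulrA -eg; exact: Ag].
  elim: e z => [|e IHe] z Nz; first by rewrite mul1r.
  by rewrite exprS -mulrA => /nx Lz; apply: IHe => //; apply: Lz; apply: ideal_mull.
- exact: ideal_mull.
Qed.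

(** With g = x^k (g' + x r) in P 0 and x in P 1 but not in P 0, the factor g' + x r lies in P 0 and
    g' in P 1; at the end a nonzero constant would lie in a prime. *)
Lemma lowest_term_prime_chain (P : nat -> set R) xs g :
  (forall i, (i <= size xs)%N -> is_prime (P i)) ->
  (forall i, (i < size xs)%N -> P i `<=` P i.+1) ->
  (forall i, (i < size xs)%N -> P i.+1 (nth 0 xs i) /\ ~ P i (nth 0 xs i)) ->
  P 0%N g -> ~ lowest_term xs g.
Proof.
elim: xs P g => [|x xs IH] P g pP sP xP P0g /=.
  move=> [c c0 eg]; have [idP P1 _] := pP 0%N isT; apply: P1.
  by rewrite -mpolyC1 -(mulVf c0) mpolyCM -eg; apply: ideal_mull.
move=> [k [g' [r [lg' eg]]]].
apply: (IH (fun i => P i.+1) g') => //.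
- by move=> i; apply: (pP i.+1).
- by move=> i; apply: (sP i.+1).
- by move=> i; apply: (xP i.+1).
have [idP P1 PM] := pP 0%N isT; have [P1x nP0x] := xP 0%N isT.
have nxk e z : P 0%N (x ^+ e * z) -> P 0%N z.
  elim: e => [|e IHe]; first by rewrite mul1r.
  by rewrite exprS -mulrA => /PM[/nP0x|/IHe].
have /(sP 0%N isT) : P 0%N (g' + x * r) by apply: (nxk k); rewrite -eg.
have [idP1 _ _] := pP 1%N isT.
by rewrite (idealDr _ idP1) //; apply: ideal_mulr.
Qed.

Definition dot (c : seq K) (V : seq R) : R := \sum_(i < size V) c`_i *: V`_i.

Lemma dot_cat c U V : dot c (U ++ V) = dot (take (size U) c) U + dot (drop (size U) c) V.
Proof.
rewrite /dot size_cat big_split_ord /=; congr (_ + _); apply: eq_bigr => i _.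
  by rewrite nth_take // nth_cat ltn_ord.
by rewrite nth_drop nth_cat ltnNge leq_addr addKn.
Qed.

(** The blocks V, xV, ..., x^(k-1) V come by increasing power, so that the first nonzero block of
    coefficients yields the lowest power of x. *)
Fixpoint power_blocks k x (V : seq R) : seq R :=
  if k is k'.+1 then V ++ [seq x * v | v <- power_blocks k' x V] else [::].

Fixpoint monomials k xs : seq R :=
  if xs is x :: xs' then power_blocks k x (monomials k xs') else [:: 1].

Lemma size_power_blocks k x V : size (power_blocks k x V) = (k * size V)%N.
Proof. by elim: k => //= k IH; rewrite size_cat size_map IH. Qed.

Lemma size_monomials k xs : size (monomials k xs) = (k ^ size xs)%N.
Proof. by elim: xs => //= x xs IH; rewrite size_power_blocks IH expnS. Qed.

Lemma dot_monomials k xs c : (exists2 i, (i < k ^ size xs)%N & c`_i != 0) ->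
  lowest_term xs (dot c (monomials k xs)).
Proof.
elim: xs c => [|x xs IH] c /=.
  move=> [[|//] _ c0]; exists c`_0 => //.
  by rewrite /dot big_ord1 -mul_mpolyC mulr1.
set V := monomials k xs in IH *; have sV : size V = (k ^ size xs)%N by apply: size_monomials.
rewrite expnS -sV; move: (V) sV IH => U sU IH.
elim: {1 2}k c => [|j IHj] c /= [i ilt ci]; first by rewrite mul0n in ilt.
rewrite dot_cat; set c1 := take _ c; set c2 := drop _ c.
have edot : dot c2 [seq x * v | v <- power_blocks j x U] = x * dot c2 (power_blocks j x U).
  rewrite /dot size_map mulr_sumr; apply: eq_bigr => q _.
  by rewrite (nth_map 0) // scalerAr.
rewrite edot.
have [c1n|c1z] := pselect (exists2 q, (q < size U)%N & c1`_q != 0).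
  exists 0%N, (dot c1 U), (dot c2 (power_blocks j x U)).
  by rewrite mul1r; split => //; apply: IH; rewrite -sU.
have -> : dot c1 U = 0.
  rewrite /dot big1 // => q _; have [->|ne] := eqVneq c1`_q 0; first by rewrite scale0r.
  by case: c1z; exists q.
have [|e [g' [r [lg' ->]]]] := IHj c2.
  have [lt|ge] := ltnP i (size U).
    by case: c1z; exists i => //; rewrite nth_take.
  exists (i - size U)%N; last by rewrite nth_drop subnKC.
  by move: ilt; rewrite mulSn; lia.
by exists e.+1, g', r; split => //; rewrite add0r exprS mulrA.
Qed.

Lemma msize_monomials k xs D v : (forall x, x \in xs -> (msize x <= D.+1)%N) ->
  v \in monomials k xs -> (msize v <= (k * size xs * D).+1)%N.
Proof.
elim: xs v => [|x xs IH] v hD /=; first by rewrite inE => /eqP ->; rewrite msize1.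
have hx : (msize x <= D.+1)%N by apply: hD; apply: mem_head.
have {}IH u : u \in monomials k xs -> (msize u <= (k * size xs * D).+1)%N.
  by apply: IH => y yxs; apply: hD; rewrite in_cons yxs orbT.
move: (monomials k xs) IH => V IH.
suff H j u : u \in power_blocks j x V -> (msize u <= (j * D + k * size xs * D).+1)%N.
  by move=> /H /leq_trans; apply; rewrite mulnS mulnDl.
elim: j u => //= j IHj u; rewrite mem_cat => /orP[/IH|/mapP[w /IHj hw ->]].
  by move/leq_trans; apply; rewrite ltnS leq_addl.
have [->|x0] := eqVneq x 0; first by rewrite mul0r msize0.
have [->|w0] := eqVneq w 0; first by rewrite mulr0 msize0.
rewrite msizeM //; move: hx hw; rewrite mulSn.
by move: (mmeasure _ x) (mmeasure _ w) => p q; lia.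
Qed.

(* Counting monomials gives a linear relation between products of the xs. *)
Lemma lowest_term0 xs : (n < size xs)%N -> lowest_term xs 0.
Proof.
move=> nxs; pose r := size xs.
pose D := \max_(x <- xs) msize x.
have hD x : x \in xs -> (msize x <= D.+1)%N.
  by move=> xxs; apply: leqW; rewrite /D; apply: leq_bigmax_seq.
(* The products have degree at most k r D, hence involve at most E^n exponents; E^n <= k^n (rD +
   1)^n < k^(n+1) <= k^r makes the products outnumber them. *)
pose k := ((r * D).+1 ^ n).+1; pose E := (k * r * D).+1.
have cnt : (E ^ n < k ^ r)%N.
  have le1 : (E <= k * (r * D).+1)%N by rewrite /E -mulnA mulnS; lia.
  have le2 : (E ^ n <= k ^ n * (r * D).+1 ^ n)%N.
    by rewrite -expnMn; case: (n) => // m; rewrite leq_exp2r.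
  apply: leq_ltn_trans le2 _; apply: (@leq_trans (k ^ n * k)).
    by rewrite ltn_pmul2l // expn_gt0.
  by rewrite -expnSr leq_pexp2l.
pose mon (m : {ffun 'I_n -> 'I_E}) : 'X_{1..n} := [multinom (m j : nat) | j < n].
pose M := \matrix_(i < k ^ r, m < #|{ffun 'I_n -> 'I_E}|)
  (monomials k xs)`_i@_(mon (enum_val m)).
have : \rank (kermx M) != 0%N.
  rewrite mxrank_ker subn_eq0 -ltnNge; apply: leq_ltn_trans (rank_leq_col M) _.
  by rewrite card_ffun !card_ord.
rewrite mxrank_eq0 => /rowV0Pn[u /sub_kermxP uM u0].
have [i ui] : exists i, u 0 i != 0.
  by apply/existsP; apply: contraNT u0; rewrite negb_exists => /forallP ui;
     apply/eqP/rowP => i; rewrite mxE; apply/eqP; move: (ui i); rewrite negbK.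
pose c := [seq u 0 i | i <- enum 'I_(k ^ r)].
have ci (j : 'I_(k ^ r)) : c`_j = u 0 j.
  by rewrite (nth_map j) ?size_enum_ord // nth_ord_enum.
suff <- : dot c (monomials k xs) = 0 by apply: dot_monomials; exists i; rewrite ?ci.
apply/mpolyP => m; rewrite mcoeff0 /dot size_monomials raddf_sum /=.
have [lt|ge] := ltnP (mdeg m) E; last first.
  rewrite big1 // => j _; rewrite mcoeffZ; apply/eqP; rewrite mulf_eq0; apply/orP; right.
  rewrite mcoeff_eq0; apply: contraL ge => /msize_mdeg_lt lt; rewrite -ltnNge.
  apply: leq_trans lt _; apply: (msize_monomials hD); apply: mem_nth.
  by rewrite size_monomials.
have mE j : (m j < E)%N by apply: leq_ltn_trans lt; rewrite mdegE (bigD1 j) //= leq_addr.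
pose m' : {ffun 'I_n -> 'I_E} := [ffun j => Ordinal (mE j)].
have em : mon m' = m by apply/mnmP => j; rewrite mnmE ffunE.
have := congr1 (fun M : 'rV_ _ => M 0 (enum_rank m')) uM; rewrite !mxE => e.
rewrite -[RHS]e; apply: eq_bigr => j _.
by rewrite mcoeffZ ci mxE enum_rankK em.
Qed.

(* If fs is regular, more than n - size fs elements are algebraically dependent modulo fs:
   otherwise together with fs they would be independent. *)
Lemma lowest_term_mod fs xs : wreg setT [set 0] fs -> (n < size fs + size xs)%N ->
  exists2 g, ext [set 0] fs g & lowest_term xs g.
Proof.
move=> reg lt; apply: (lowest_term_ext _ reg (erefl : [set 0] (0 : R))) => //.
by apply: lowest_term0; rewrite size_cat.
Qed.

End AlgebraicRelations.

(** * Socles and Cohen-Macaulayness *)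

Section Socle.
Variables (K : fieldType) (n : nat).
Local Notation R := {mpoly K[n]}.
Implicit Types (I J Q : set R) (x y z g l : R) (xs gs ls : seq R).

Lemma linear_formE l : l \is 1.-homog -> l = \sum_(j < n) l@_U_(j) *: 'X_j.
Proof.
move=> hl; apply/mpolyP => m; rewrite raddf_sum /=.
under eq_bigr => j _ do rewrite mcoeffZ mcoeffX.
have [/mdeg1P[i /eqP->]|ne] := boolP (mdeg m == 1%N).
  rewrite (bigD1 i) //= eqxx mulr1 big1 ?addr0 // => j ji.
  by rewrite eq_mnm1 (negPf ji) mulr0.
rewrite (dhomog_nemf_coeff hl ne) big1 // => j _.
by case: eqP => [em|]; [rewrite -em mdeg1 in ne|rewrite mulr0].
Qed.

Lemma ideal_linear_form J l z : is_ideal J -> l \is 1.-homog ->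
  (forall i : 'I_n, J ('X_i * z)) -> J (l * z).
Proof.
move=> idJ /linear_formE -> H; rewrite mulr_suml; apply: ideal_sum => // i _.
by rewrite -scalerAl -mul_mpolyC; apply: ideal_mull.
Qed.

(* A linear projection of the variables with kernel spanned by ls induces an
   endomorphism of R with kernel (ls); so R/(ls) is a domain with a nonzero variable. *)
Lemma no_socle_linear ls : (size ls < n)%N -> (forall l, l \in ls -> l \is 1.-homog) ->
  no_socle (ext [set 0] ls).
Proof.
move=> lt hls; set Q := ext [set 0] ls; have idQ : is_ideal Q by apply: ideal_ext.
(* The rows of A are the coefficients of ls. As A P = A, the projection [Pi] kills them. *)
pose A := \matrix_(i < size ls, j < n) (ls`_i)@_U_(j).
pose P := pinvmx A *m A; pose Pi := 1%:M - P.
have APi : A *m Pi = 0 by rewrite mulmxBr mulmx1 mulmxA mulmxKpV // subrr.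
have [phi [phiD phiM phiC phiX]] : exists phi : R -> R,
    [/\ {morph phi : x y / x + y}, {morph phi : x y / x * y},
        (forall c, phi c%:MP = c%:MP) & forall i, phi 'X_i = \sum_j Pi i j *: 'X_j].
  exists (comp_mpoly [tuple \sum_j Pi i j *: ('X_j : R) | i < n]); split.
  - exact: raddfD.
  - exact: rmorphM.
  - by move=> c; apply: comp_mpolyC.
  - by move=> i; rewrite comp_mpolyXU -tnth_nth tnth_mktuple.
have phi0 : phi 0 = 0 by have := phiC 0; rewrite mpolyC0.
have phiZ c p : phi (c *: p) = c *: phi p by rewrite -!mul_mpolyC phiM phiC.
have phi_sum m (F : 'I_m -> R) : phi (\sum_i F i) = \sum_i phi (F i).
  exact: (big_morph phi phiD phi0).
have phi_ls l : l \in ls -> phi l = 0.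
  move=> lls; have /(nthP 0)[q qlt el] := lls; pose i := Ordinal qlt.
  rewrite (linear_formE (hls l lls)) phi_sum.
  under eq_bigr => j _ do rewrite phiZ phiX scaler_sumr.
  rewrite exchange_big big1 //= => k _.
  under eq_bigr => j _ do rewrite scalerA.
  rewrite -scaler_suml; have := congr1 (fun M : 'M_(_, _) => M i k) APi; rewrite !mxE => e.
  rewrite (_ : \sum_(j < n) _ = 0) ?scale0r // -[RHS]e.
  by apply: eq_bigr => j _; rewrite !mxE /= el.
have phiQ z : Q z -> phi z = 0.
  move: z; apply: (ext_min (J := [set z | phi z = 0])) => //.
    by split=> [|x y /= ex ey|r x /= ex] //=; rewrite ?phiD ?phiM ex ?ey ?addr0 ?mulr0.
  by move=> z /= ->.
(* Since z and [phi z] agree modulo ls, the kernel of [phi] is no larger than Q. *)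
have subQ z : Q (z - phi z).
  have Qc c : Q (c%:MP - phi c%:MP) by rewrite phiC subrr; apply: ideal0.
  have QM x y : Q (x - phi x) -> Q (y - phi y) -> Q (x * y - phi (x * y)).
    move=> Qx Qy; rewrite phiM.
    rewrite (_ : _ - _ = x * (y - phi y) + phi y * (x - phi x)); last by ring.
    by apply: idealD => //; apply: ideal_mull.
  have QX i : Q ('X_i - phi 'X_i).
    have -> : 'X_i - phi 'X_i = \sum_(q < size ls) (pinvmx A i q)%:MP * ls`_q.
      under [RHS]eq_bigr => q _ do
        rewrite (linear_formE (hls _ (mem_nth 0 (ltn_ord q)))) mulr_sumr.
      rewrite exchange_big /= phiX.
      rewrite [X in X - _](_ : _ = \sum_j (i == j)%:R *: 'X_j); last first.
        rewrite (bigD1 i) //= eqxx scale1r big1 ?addr0 // => j ji.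
        by rewrite eq_sym (negPf ji) scale0r.
      rewrite -sumrB; apply: eq_bigr => j _; rewrite -scalerBl !mxE opprB addrC subrK.
      rewrite scaler_suml; apply: eq_bigr => q _.
      by rewrite mul_mpolyC scalerA !mxE.
    apply: ideal_sum => // q _; apply: ideal_mull => //; apply: ext_mem => //.
    exact: mem_nth.
  have Q1 : Q (1 - phi 1) by rewrite -mpolyC1.
  rewrite [z]mpolyE; elim: (msupp z) => [|m s IH].
    by rewrite big_nil phi0 subrr; apply: ideal0.
  rewrite big_cons phiD opprD addrACA; apply: idealD => //.
  rewrite -mul_mpolyC; apply: (QM) => //; rewrite mpolyXE_id.
  apply: (big_ind (fun x => Q (x - phi x))) => [|x y|i _]; [exact: Q1|exact: QM|].
  elim: (m i) => [|k IHk]; first by rewrite expr0.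
  by rewrite exprS; apply: QM.
(* If every variable were killed, [Pi] would vanish and the identity would have rank at most
   [size ls], which is less than n. *)
have [i phiXn0] : exists i, phi 'X_i != 0.
  apply: contrapT => H.
  have Pi0 : Pi = 0.
    apply/matrixP => i k; rewrite [RHS]mxE; have : phi 'X_i = 0.
      by apply/eqP; apply: contrapT => /negP ne; apply: H; exists i.
    rewrite phiX => /(congr1 (mcoeff U_(k))); rewrite raddf_sum /= mcoeff0 (bigD1 k) //=.
    rewrite mcoeffZ mcoeffXU eqxx mulr1 big1 ?addr0 // => j jk.
    by rewrite mcoeffZ mcoeffXU (negPf jk) mulr0.
  have : (\rank (1%:M : 'M[K]_n) <= size ls)%N.
    have -> : 1%:M = P by apply/eqP; rewrite -subr_eq0 -/Pi Pi0.
    by apply: leq_trans (mxrankM_maxr _ _) (rank_leq_row _).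
  by rewrite mxrank1 leqNgt lt.
move=> z /(_ i)/phiQ; rewrite phiM => /eqP.
rewrite mulf_eq0 (negPf phiXn0) => /eqP pz.
by rewrite -[z]subr0 -pz.
Qed.

(* R is Cohen-Macaulay: no socle appears before a regular sequence has length n.
   A form g of the sequence is exchanged for a linear form l: if z is a socle element
   modulo (Q, g) and l z = g w modulo Q, then w is one modulo (Q, l). *)
Lemma no_socle_regular ls gs : infinite_set [set: K] -> (size ls + size gs < n)%N ->
  (forall l, l \in ls -> l \is 1.-homog) -> (forall g, g \in gs -> posform g) ->
  wreg setT [set 0] (ls ++ gs) -> no_socle (ext [set 0] (ls ++ gs)).
Proof.
move=> infK; elim/last_ind: gs ls => [|gs g IH] ls lt hls hgs.
  by rewrite cats0 => _; apply: no_socle_linear; rewrite // -[size ls]addn0.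
rewrite -rcons_cat => /wreg_rcons[reg ng]; rewrite ext_rcons.
move: lt; rewrite size_rcons => lt.
have {}hgs x : x \in gs -> posform x.
  by move=> xgs; apply: hgs; rewrite mem_rcons in_cons xgs orbT.
set Q := ext _ _ in ng *; have idQ : is_ideal Q by apply: ideal_ext.
have nsQ : no_socle Q by apply: IH => //; lia.
have [l hl /(_ tt) nl] := linear_nonzerodivisor infK (fun _ : unit => idQ) (fun => nsQ).
have nsl : no_socle (quo Q setT l).
  have -> : quo Q setT l = ext [set 0] (rcons ls l ++ gs).
    rewrite -ext_rcons; apply: eq_ext => // x.
    by rewrite !(mem_rcons, mem_cat, in_cons) orbA.
  apply: IH => //; first by rewrite size_rcons; lia.
    by move=> x; rewrite mem_rcons in_cons => /predU1P[->//|/hls].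
  (* By construction l is regular after gs; regular sequences of forms may be rotated, so l can move
     in front of gs. *)
  rewrite cat_rcons; apply/wreg_cat; rewrite lend_setT.
  have : wreg setT [set 0] (ls ++ rcons gs l).
    by rewrite -rcons_cat; apply/wreg_rcons.
  move=> /wreg_cat[regls]; rewrite lend_setT => regl; split => //.
  apply/wreg_rot => //; last by exists 1%N.
  apply: homog_ideal_ext; first exact: homog_ideal_zero.
  by move=> x /hls hx; exists 1%N.
move=> z zsoc; have idg : is_ideal (quo Q setT g) by apply: ideal_quo.
have [q [w [Qq _ elz]]] := ideal_linear_form idg hl zsoc.
have [q' [v [Qq' _ ew]]] : quo Q setT l w.
  apply: nsl => i; have [q'' [v [Qq'' _ eXz]]] := zsoc i.
  exists ('X_i * w - l * v), v; split => //; last by rewrite subrK.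
  apply: ng; rewrite (_ : g * _ = l * q'' - 'X_i * q).
    by apply: idealB => //; apply: ideal_mull.
  have -> : q = l * z - g * w by rewrite elz addrK.
  have -> : q'' = 'X_i * z - g * v by rewrite eXz addrK.
  by ring.
exists (z - g * v), v; split => //; last by rewrite subrK.
apply: nl; rewrite mulrBr elz ew.
rewrite (_ : _ - _ = q + g * q'); last by ring.
by apply: idealD => //; apply: ideal_mull.
Qed.

(** One linear form at a time serves all i at once, because each partial sequence has length below n
    and so leaves no socle. *)
Lemma regular_family_extension (T : finType) (gs : T -> seq R) t :
  infinite_set [set: K] -> (forall i, size (gs i) + t <= n)%N ->
  (forall i g, g \in gs i -> posform g) -> (forall i, wreg setT [set 0] (gs i)) ->
  exists ls : seq R, [/\ size ls = t, (forall l, l \in ls -> l \is 1.-homog) &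
    forall i, wreg setT (ext [set 0] (gs i)) ls].
Proof.
move=> infK; elim: t => [|t IH] le hgs reg; first by exists [::].
have [i|ls [sls hls regls]] := IH _ hgs reg.
  by apply: leq_trans (le i); rewrite leq_add2l.
have [i|i|l hl nl] := @linear_nonzerodivisor K n T (fun i => ext [set 0] (gs i ++ ls)) infK.
- exact: ideal_ext.
- apply: (@no_socle_regular [::]) => //.
  + by rewrite add0n size_cat sls; apply: leq_trans (le i); rewrite addnS.
  + by move=> g; rewrite mem_cat => /orP[/hgs//|/hls hg]; exists 1%N.
  + rewrite cat0s; apply/wreg_cat; rewrite lend_setT; split; [exact: reg|exact: regls].
exists (rcons ls l); split; first by rewrite size_rcons sls.
  by move=> x; rewrite mem_rcons in_cons => /predU1P[->//|/hls].
by move=> i; apply/wreg_rcons; split => //; rewrite -ext_cat.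
Qed.

End Socle.

(** * Filtrations with cyclic quotients, depth and dimension *)

Section Filtrations.
Variables (K : fieldType) (n : nat).
Local Notation R := {mpoly K[n]}.
Implicit Types (I J L N P Q p : set R) (F : set (set R)) (x y z g l u : R).
Implicit Types (xs gs ls : seq R).

(* N/L has a filtration with cyclic quotients R/P, P in F. *)
Inductive filtered F L : set R -> Prop :=
| filtered_refl : filtered F L L
| filtered_step N u : filtered F L N -> F (colon N u) -> filtered F L (quo N setT u).

Lemma filtered_sub F F' L N : F `<=` F' -> filtered F L N -> filtered F' L N.
Proof.
move=> FF'; elim=> [|N' u _ IH FN]; first exact: filtered_refl.
by apply: filtered_step => //; apply: FF'.
Qed.

Lemma filtered_trans F L N N' : filtered F L N -> filtered F N N' -> filtered F L N'.
Proof. by move=> LN; elim=> // N'' u _ IH FN; apply: filtered_step. Qed.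

Lemma filtered_ideal F L N : is_ideal L -> filtered F L N -> is_ideal N /\ L `<=` N.
Proof.
move=> idL; elim=> [|N' u _ [idN LN] _]; first by split.
by split; [exact: ideal_quo|apply: subset_trans LN _; exact: quo_subl].
Qed.

(** Either y has a multiple in the previous step N' with the same annihilator, where induction
    applies, or its annihilator is that of its class modulo N', in a copy of some R/P. *)
Lemma filtered_associated F L N y : is_ideal L -> filtered F L N ->
  N y -> is_prime (colon L y) -> exists P r, F P /\ colon L y = colon P r.
Proof.
move=> idL fil; elim: fil y => [|N' u fil IH FN] y.
  by move=> Ly [_ /(_ _)[]]; rewrite /colon /= mul1r.
have [idN LN] := filtered_ideal idL fil.
move=> [y0 [r [Ny0 _ ey]]] pr; have [idp p1 pM] := pr.
have [[w nw Nwy]|H] := pselect (exists2 w, ~ colon L y w & N' (w * y)).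
  have eqc : colon L (w * y) = colon L y.
    apply/seteqP; split=> v; rewrite /colon /=.
      by rewrite mulrA => /pM[].
    by move=> Lvy; rewrite mulrCA; apply: ideal_mull.
  by rewrite -eqc; apply: IH; rewrite ?eqc.
exists (colon N' u), r; split => //; apply/seteqP; split=> v; rewrite /colon /=.
  move=> /LN; rewrite ey mulrDr (idealDl _ idN); last exact: ideal_mull.
  by rewrite -mulrA (mulrC r).
move=> Nvru; apply: contrapT => nv; apply: H; exists v => //.
by rewrite ey mulrDr; apply: idealD => //; [exact: ideal_mull|rewrite (mulrC u) mulrA].
Qed.

Lemma filtered_wreg F L N xs : is_ideal L -> filtered F L N ->
  (forall P, F P -> wreg setT P xs) -> wreg N L xs.
Proof.
move=> idL fil regF; elim: fil => [|N' u fil IH FN].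
  elim: xs (L) {regF} idL => //= x xs IH L' idL'; split => //.
  have -> : quo L' L' x = L'.
    apply/seteqP; split; last exact: quo_subl.
    by apply: quo_min => // y; apply: ideal_mull.
  exact: IH.
have [idN LN] := filtered_ideal idL fil.
apply: (wreg_extension _ idN) IH _ => //; [exact: ideal_quo|exact: quo_subl|].
exact: wreg_cyclic (regF _ FN).
Qed.

Lemma filtered_lowest_term F L N xs : is_ideal L -> filtered F L N ->
  (forall P, F P -> exists2 g, P g & lowest_term xs g) ->
  exists2 g, ann N L g & lowest_term xs g.
Proof.
move=> idL fil lowF; elim: fil => [|N' u fil [g Ag lg] FN].
  by exists 1; [move=> y /= Ly; rewrite mul1r|exact: lowest_term1].
have [h Ph lh] := lowF _ FN; exists (g * h); last exact: lowest_termM.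
move=> _ [v [r [Nv _ ->]]]; rewrite -mulrA; apply: Ag; rewrite mulrDr.
have [idN _] := filtered_ideal idL fil.
apply: idealD => //; first exact: ideal_mull.
by rewrite mulrA; apply: ideal_mulr.
Qed.

Lemma filtered_nonzero F L N : filtered F L N -> ~ N `<=` L ->
  exists N' u, [/\ filtered F L N', F (colon N' u) & N = quo N' setT u].
Proof. by case=> [|N' u fil FN] H; [case: H|exists N', u]. Qed.

Lemma is_ideal_max : is_ideal (max_ideal K n). Proof. exact: is_ideal_gen. Qed.

Lemma max_idealE g : max_ideal K n g <-> g@_0%MM = 0.
Proof.
split.
  move: g; apply: (ideal_gen_min (J := [set g | g@_0%MM = 0])).
    split=> [|x y /= ex ey|r x /= ex] /=; first by rewrite mcoeff0.
      by rewrite mcoeffD ex ey addr0.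
    by rewrite rmorphM /= ex mulr0.
  by move=> _ [i _ <-] /=; rewrite mcoeffX mnm1_eq0.
move=> g0; rewrite [g]mpolyE big_seq; apply: ideal_sum is_ideal_max _ => m mg; have m0 : m != 0%MM.
  by apply: contraTneq mg => ->; rewrite -mcoeff_eq0 g0.
have [i mi] : exists i, m i != 0%N.
  apply/existsP; apply: contraNT m0; rewrite negb_exists => /forallP H.
  by apply/eqP/mnmP => i; rewrite mnm0E; apply/eqP; rewrite -[_ == _]negbK.
have -> : m = (m - U_(i) + U_(i))%MM by rewrite submK // lep1mP.
rewrite mpolyXD scalerAl; apply: ideal_mull is_ideal_max _.
by apply: ideal_gen_sub; exists i.
Qed.

Lemma max_ideal1 : ~ max_ideal K n 1.
Proof. by move/max_idealE/eqP; rewrite mcoeff1 eqxx oner_eq0. Qed.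

Lemma max_ideal_prime : is_prime (max_ideal K n).
Proof.
split; [exact: is_ideal_max|exact: max_ideal1|].
move=> x y /max_idealE; rewrite rmorphM /= => /eqP; rewrite mulf_eq0.
by case/orP => /eqP e; [left|right]; apply/max_idealE.
Qed.

Lemma posform_max x : posform x -> max_ideal K n x.
Proof.
move=> [d d0 hx]; apply/max_idealE; apply: (dhomog_nemf_coeff hx).
by rewrite mf0 neq_ltn d0.
Qed.

(* Nakayama for the last cyclic quotient of a filtration. *)
Lemma lend_cyclic N L u xs : is_ideal N -> L `<=` N ->
  (forall x, x \in xs -> max_ideal K n x) ->
  quo N setT u `<=` lend (quo N setT u) L xs -> ~ colon N u `<=` max_ideal K n.
Proof.
move=> idN LN hxs sub cm; pose mu := quo N (colon (max_ideal K n) 1) u.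
have idm := is_ideal_max; have idc : is_ideal (colon (max_ideal K n) 1) by apply: ideal_colon.
have idmu : is_ideal mu by apply: ideal_quo.
have lmu : lend (quo N setT u) L xs `<=` mu.
  have : L `<=` mu by apply: subset_trans LN _; apply: quo_subl.
  elim: xs hxs (L) {sub LN} => //= x xs IH hxs L' L'mu; apply: IH.
    by move=> y yxs; apply: hxs; rewrite in_cons yxs orbT.
  apply: quo_min => // _ [v [r [Nv _ ->]]]; rewrite mulrDr; apply: (idealD idmu).
    exact: (quo_subl u idc (ideal_mull x idN Nv)).
  rewrite mulrCA; apply: (quo_gen u idN); rewrite /colon /= mulr1.
  by apply: (ideal_mulr _ idm); apply: hxs; apply: mem_head.
have [v [r [Nv mr eu]]] : mu u by apply: lmu; apply: sub; apply: quo_mem.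
have /cm m1r : colon N u (1 - r).
  by rewrite /colon /= mulrBl mul1r {1}eu (mulrC u) addrK.
apply: max_ideal1; rewrite -(subrK r 1); apply: (idealD idm) => //.
by move: mr; rewrite /colon /= mulr1.
Qed.

(** The chain is built downwards from p: below a prime containing Q + (l), [prime_avoiding] yields
    one that contains Q but not l. *)
Lemma prime_chain_regular Q p ls : is_ideal Q -> is_prime p -> ext Q ls `<=` p ->
  wreg setT Q ls -> prime_chain Q (size ls).
Proof.
move=> idQ pp; elim: ls Q idQ => [|l ls IH] Q idQ /= extp.
  by move=> _; exists (fun=> p).
move=> [nl reg]; have idQl : is_ideal (quo Q setT l) by apply: ideal_quo.
have [P [pP sP]] := IH _ idQl extp reg.
have [pP0 QP0] := pP 0%N isT.
have [||q [pq Qq qP nql]] := prime_avoiding (l := l) idQ pP0.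
- by apply: subset_trans QP0; apply: quo_subl.
- by move=> z; apply: nl.
exists (fun i => if i is j.+1 then P j else q); split.
  case=> [|i] //; rewrite ltnS => /pP[? QP]; split => //.
  by apply: subset_trans QP; apply: quo_subl.
case=> [|i]; last by rewrite ltnS => /sP.
by move=> _; split => // H; apply: nql; apply: H; apply: QP0; apply: quo_mem.
Qed.

Lemma prime_chain_sub I J t : I `<=` J -> prime_chain J t -> prime_chain I t.
Proof.
move=> IJ [P [pP sP]]; exists P; split => // i /pP[? JP]; split => //.
exact: subset_trans JP.
Qed.

(** The n - c linear forms ls are regular on every quotient, which bounds depth and dimension from
    below; algebraic relations among more than n - c elements bound both from above. *)
Lemma filtered_cohen_macaulay (T : finType) (gs : T -> seq R) c L N :
  infinite_set [set: K] -> (c <= n)%N -> (forall i, size (gs i) = c) ->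
  (forall i g, g \in gs i -> posform g) -> (forall i, wreg setT [set 0] (gs i)) ->
  is_ideal L -> filtered [set P | exists i, P = ext [set 0] (gs i)] L N -> ~ N `<=` L ->
  cohen_macaulay (max_ideal K n) N L /\ has_dim N L (n - c).
Proof.
move=> infK cn sgs hgs reg idL fil NL; set F := [set P | _] in fil.
have [|ls [sls hls regls]] := regular_family_extension (t := n - c) infK _ hgs reg.
  by move=> i; rewrite sgs subnKC.
have [idN LN] := filtered_ideal idL fil.
have low xs : (n - c < size xs)%N -> exists2 g, ann N L g & lowest_term xs g.
  move=> lt; apply: filtered_lowest_term fil _ => // _ [i ->].
  by apply: lowest_term_mod => //; rewrite sgs; lia.
have [N' [u [fil' [i0 eP] eN]]] := filtered_nonzero fil NL.
have [idN' LN'] := filtered_ideal idL fil'.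
have lsm l : l \in ls -> max_ideal K n l.
  by move=> /hls hl; apply: posform_max; exists 1%N.
have gsm g : g \in gs i0 -> max_ideal K n g by move=> /hgs; apply: posform_max.
have idm := is_ideal_max.
have cm : colon N' u `<=` max_ideal K n.
  by rewrite eP; apply: ext_min => // z ->; apply: ideal0.
have dimN : has_dim N L (n - c).
  split.
    rewrite -sls; apply: (@prime_chain_sub _ (ext [set 0] (gs i0))).
      rewrite -eP => g Ag; apply: LN'; apply: Ag; rewrite eN; exact: quo_mem.
    apply: (@prime_chain_regular _ (max_ideal K n)) => //; [exact: ideal_ext|
      exact: max_ideal_prime|].
    by rewrite -eP; apply: ext_min.
  move=> t' [P [pP sP]]; rewrite leqNgt; apply/negP => lt.
  (* Elements separating consecutive primes, with default value 0 past the end of the chain. *)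
  have /choice[x xP] : forall i, exists x, (i < t')%N -> P i.+1 x /\ ~ P i x.
    move=> i; have [/sP[_ sPi]|_] := ltnP i t'; last by exists 0.
    apply: contrapT => H; apply: sPi => z Pz; apply: contrapT => nPz.
    by apply: H; exists z.
  have [|g Ag lg] := low (mkseq x t'); first by rewrite size_mkseq.
  have [_ annP] := pP 0%N isT.
  apply: (lowest_term_prime_chain (P := P) _ _ _ (annP _ Ag) lg); rewrite size_mkseq.
  - by move=> i /pP[].
  - by move=> i /sP[].
  - by move=> i lti; rewrite nth_mkseq //; apply: xP.
split => //; exists (n - c)%N => //; split.
  exists ls; split => //; apply/regular_seqE; split.
    by apply: filtered_wreg fil _ => // _ [i ->].
  by rewrite eN => /(lend_cyclic idN' LN' lsm).
move=> xs _ rxs; rewrite leqNgt; apply/negP => /low[g Ag].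
exact: lowest_term_regular rxs Ag.
Qed.

End Filtrations.

(** * Exponents *)

Section Exponents.
Variable s : nat.
Local Notation exponent := {ffun 'I_s -> nat}.
Implicit Types (k v : exponent) (A B X Y : {set 'I_s}) (g : 'I_s -> nat).
Local Open Scope nat_scope.

Lemma leq_sum_sets g e X Y : #|X| <= #|Y| ->
  (forall i j, i \in X -> j \in Y -> g i + e <= g j) ->
  \sum_(i in X) g i + e * #|X| <= \sum_(j in Y) g j.
Proof.
move=> cXY gXY; have [->|[i0 i0X]] := set_0Vmem X.
  by rewrite big_set0 cards0 muln0.
have [i iX imax] := arg_maxnP g i0X.
apply: (@leq_trans (\sum_(j in X) (g i + e))).
  rewrite (mulnC e) -sum_nat_const -big_split /=.
  by apply: leq_sum => j jX; rewrite leq_add2r; apply: imax.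
rewrite sum_nat_const; apply: (@leq_trans (#|Y| * (g i + e))); first by rewrite leq_mul2r cXY orbT.
by rewrite -sum_nat_const; apply: leq_sum => j; apply: gXY.
Qed.

Lemma leq_sum_exchange g e A B : #|A| <= #|B| ->
  (forall i j, i \in A :\: B -> j \in B :\: A -> g i + e <= g j) ->
  \sum_(i in A) g i + e * #|A :\: B| <= \sum_(j in B) g j.
Proof.
move=> cAB gAB; rewrite (big_setID B) [X in _ <= X](big_setID A) /= finset.setIC -addnA leq_add2l.
apply: leq_sum_sets => //.
by have := cardsID B A; have := cardsID A B; rewrite finset.setIC; lia.
Qed.

(* Ties between exponents are broken by the index, so weights are distinct. *)
Definition weight k (i : 'I_s) : nat := k i * s + i.

Lemma weight_inj k : injective (weight k).
Proof.
move=> i j /(congr1 (modn^~ s)); rewrite /weight !modnMDl !modn_small //.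
by move/val_inj.
Qed.

Lemma weight_lt_leq k i j : weight k i < weight k j -> k i <= k j.
Proof.
rewrite /weight => lt; rewrite leqNgt; apply/negP => kk; move: (leq_mul kk (leqnn s)) lt.
by rewrite mulSn; have := ltn_ord j; lia.
Qed.

Definition lowest k A : Prop := forall i j, i \notin A -> j \in A -> weight k j < weight k i.

Lemma lowest_exists k c : c <= s -> exists2 A : {set 'I_s}, #|A| = c & lowest k A.
Proof.
elim: c => [|c IH] cs; first by exists finset.set0; rewrite ?cards0 // => i j _; rewrite inE.
have [A cA lA] := IH (ltnW cs).
have [i0 i0A] : exists i, i \notin A.
  apply/existsP; rewrite -negb_forall; apply: contraTN cs => /forallP AT.
  rewrite -leqNgt -cA -[X in X <= _]card_ord; apply: subset_leq_card.
  by apply/fintype.subsetP => x _; apply: AT.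
have [i iA imin] := @arg_minnP _ i0 (fun i => i \notin A) (weight k) i0A.
exists (i |: A); first by rewrite cardsU1 iA cA.
move=> j l; rewrite !inE negb_or => /andP[ji jA] /predU1P[->|]; last exact: lA.
rewrite ltn_neqAle imin // andbT; apply: contra ji => /eqP/weight_inj->.
by [].
Qed.

Lemma lowest_sub k A B : lowest k A -> lowest k B -> #|B| <= #|A| -> B \subset A.
Proof.
move=> lA lB cBA; apply/fintype.subsetP => x xB; apply: contraT => xA.
have [y yA yB] : exists2 y, y \in A & y \notin B.
  apply/fintype.subsetPn; apply: contraTN isT => AB.
  have eAB : A = B by apply/eqP; rewrite eqEcard AB.
  by rewrite eAB xB in xA.
by have := lA x y xA yA; have := lB y x yB xB; lia.
Qed.

Lemma lowest_weight k A B : lowest k A -> #|B| = #|A| ->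
  \sum_(i in A) weight k i + #|A :\: B| <= \sum_(i in B) weight k i.
Proof.
move=> lA cBA; rewrite -[#|_ :\: _|]mul1n; apply: leq_sum_exchange; rewrite ?cBA // => i j.
by rewrite !inE addn1 => /andP[_ iA] /andP[jA _]; apply: lA.
Qed.

Lemma lowest_weight_lt k A B : lowest k A -> #|B| = #|A| -> B != A ->
  \sum_(i in A) weight k i < \sum_(i in B) weight k i.
Proof.
move=> lA cBA ne; apply: leq_trans (lowest_weight lA cBA).
rewrite -addn1 leq_add2l card_gt0 finset.setD_eq0; apply: contra ne => AB.
by rewrite eq_sym eqEcard AB cBA /=.
Qed.

Variables (beta D : nat).

Definition deficit A k : nat := \sum_(i in A) (beta - k i).

Lemma lowest_deficit k A B : lowest k A -> #|B| <= #|A| -> deficit B k <= deficit A k.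
Proof.
move=> lA cBA; rewrite /deficit -[X in X <= _]addn0 -[X in _ + X](mul0n #|B :\: A|).
apply: leq_sum_exchange => // i j; rewrite !inE addn0 => /andP[iA _] /andP[_ jA].
by apply/leq_sub2l/weight_lt_leq/lA.
Qed.

Definition le_exp k v : Prop := forall i, k i <= v i.

Lemma deficit_le A k v : (forall i, i \in A -> k i <= v i) -> deficit A v <= deficit A k.
Proof. by move=> kv; apply: leq_sum => i iA; apply/leq_sub2l/kv. Qed.

Lemma deficit_sub A B k : A \subset B -> deficit A k <= deficit B k.
Proof.
by move=> AB; rewrite /deficit [X in _ <= X](big_setID A) (finset.setIidPr AB) leq_addr.
Qed.

(* With beta = m * b, D = m * (h - 1) and c = h.+1 these are the exponents of the monomials
   of the m-th symbolic power; smaller c omit the components of codimension at least c. *)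
Definition small_deficits c k : Prop := forall B, #|B| < c -> deficit B k <= D.

Lemma small_deficits_le c k v : le_exp k v -> small_deficits c k -> small_deficits c v.
Proof. by move=> kv sk B /sk; apply: leq_trans; apply: deficit_le. Qed.

Lemma small_deficitsS c k : small_deficits c.+1 k -> small_deficits c k.
Proof. by move=> sk B cB; apply/sk/ltnW. Qed.

(** A holds the c smallest entries of k, and its deficit is what keeps k out of the next level. As
    weights are distinct, k and c determine A. *)
Record cell c k A : Prop := Cell {
  cell_card : #|A| = c;
  cell_lowest : lowest k A;
  cell_small : small_deficits c k;
  cell_bad : D < deficit A k }.

Lemma cell_exists c k : c <= s -> small_deficits c k -> ~ small_deficits c.+1 k ->
  exists A, cell c k A.
Proof.
move=> cs sk nsk; have [A cA lA] := lowest_exists k cs; exists A; split => //.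
rewrite ltnNge; apply/negP => dA; apply: nsk => B; rewrite ltnS => cB.
by apply: leq_trans dA; apply: lowest_deficit; rewrite ?cA.
Qed.

(** If i contributed no deficit, A without i would already violate the bound for sets of fewer than
    c elements. *)
Lemma cell_lt_beta c k A i : cell c k A -> i \in A -> k i < beta.
Proof.
move=> [cA _ sk bA] iA; rewrite -subn_gt0.
have := sk (A :\ i); have := cardsD1 i A; rewrite iA cA add1n => -> /(_ (ltnSn _)).
by move: bA; rewrite /deficit (big_setD1 i) //=; lia.
Qed.

(* The least exponent that agrees with k on A and for which A is lowest. *)
Definition cell_gen A k : exponent :=
  [ffun i => if i \in A then k i else (\max_(j in A) weight k j + s - i) %/ s].

Lemma cell_gen_in A k i : i \in A -> cell_gen A k i = k i.
Proof. by rewrite ffunE => ->. Qed.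

(** The quotient is the least t with t s + i above all weights on A; s - i is not truncated because
    i < s. *)
Lemma cell_gen_out A k i t : i \notin A ->
  (cell_gen A k i <= t) = (\max_(j in A) weight k j < t * s + i).
Proof.
move=> iA; rewrite ffunE (negPf iA) -ltnS ltn_divLR; last by apply: leq_ltn_trans (ltn_ord i).
by rewrite mulSn; have := ltn_ord i; case: (\max_(_ in _) _) => [|m]; lia.
Qed.

Lemma eq_cell_gen A k v : (forall i, i \in A -> k i = v i) -> cell_gen A k = cell_gen A v.
Proof.
move=> kv; have ew : \max_(j in A) weight k j = \max_(j in A) weight v j.
  by apply: eq_bigr => j jA; rewrite /weight kv.
by apply/ffunP => i; rewrite !ffunE ew; case: ifP => // /kv.
Qed.

Lemma cell_gen_id A k : cell_gen A (cell_gen A k) = cell_gen A k.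
Proof. by apply: eq_cell_gen => i; apply: cell_gen_in. Qed.

Lemma cell_gen_weight A k i : i \in A -> weight (cell_gen A k) i = weight k i.
Proof. by move=> iA; rewrite /weight cell_gen_in. Qed.

Lemma cell_gen_lowest A k : lowest (cell_gen A k) A.
Proof.
move=> i j iA jA; rewrite (cell_gen_weight _ jA).
apply: (@leq_ltn_trans (\max_(l in A) weight k l)); first exact: leq_bigmax_cond.
by rewrite {2}/weight -(cell_gen_out k _ iA).
Qed.

Lemma cell_gen_deficit A B k : B \subset A -> deficit B (cell_gen A k) = deficit B k.
Proof.
by move/fintype.subsetP => BA; apply: eq_bigr => i /BA iA; rewrite cell_gen_in.
Qed.

Lemma cell_gen_le c k A : cell c k A -> le_exp (cell_gen A k) k.
Proof.
move=> ck i; have [iA|iA] := boolP (i \in A); first by rewrite cell_gen_in.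
have [i0 i0A] : exists i, i \in A.
  apply/set0Pn; apply: contraTneq (cell_bad ck) => ->.
  by rewrite /deficit big_set0.
rewrite cell_gen_out //; have [|j jA ->] := @eq_bigmax_cond _ (mem A) (weight k).
  by rewrite (cardD1 i0) i0A.
exact: (cell_lowest ck iA jA).
Qed.

(** Small deficits need only be tested on the lowest set of each size below c, and these sets lie
    inside A, where the exponent is unchanged. *)
Lemma cell_gen_cell c k A : cell c k A -> cell c (cell_gen A k) A.
Proof.
move=> [cA lA sk bA]; have lg := @cell_gen_lowest A k; split => //; last first.
  by rewrite cell_gen_deficit.
move=> B cB; have [|A' cA' lA'] := @lowest_exists (cell_gen A k) #|B|.
  by have := max_card (mem B); rewrite card_ord.
apply: (@leq_trans (deficit A' (cell_gen A k))); first by apply: lowest_deficit; rewrite ?cA'.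
by rewrite cell_gen_deficit; [apply: sk; rewrite cA'|apply: lowest_sub lg lA' _; rewrite cA' cA ltnW].
Qed.

(** This makes the cell generators finite in number: entries on A are below [beta], so weights on A
    are below [beta * s] and [beta] suffices off A. *)
Lemma cell_gen_bound c v A : cell c v A -> v = cell_gen A v -> forall i, v i <= beta.
Proof.
move=> cv ev i; have [iA|iA] := boolP (i \in A); first by rewrite ltnW ?(cell_lt_beta cv).
rewrite ev cell_gen_out //; have s0 : 0 < s by apply: leq_ltn_trans (ltn_ord i).
have b0 : 0 < beta.
  have := cell_bad cv; rewrite /deficit; case: beta => [|//].
  by rewrite big1.
suff : \max_(j in A) weight v j <= (beta * s).-1.
  by move: (muln_gt0 beta s); rewrite b0 s0 => /=; lia.
apply/bigmax_leqP => j jA; have := cell_lt_beta cv jA; rewrite /weight => lt.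
have := ltn_ord j; have := leq_mul lt (leqnn s); rewrite mulSn; lia.
Qed.

Definition incr k (j : 'I_s) : exponent := [ffun i => k i + (i == j)].

(** If A' = A, the weight of j grows by s; otherwise A' already outweighs A for v, and raising an
    entry lowers no weight. *)
Lemma cell_incr_weight c v A j A' : cell c v A -> j \in A -> cell c (incr v j) A' ->
  \sum_(i in A) weight v i < \sum_(i in A') weight (incr v j) i.
Proof.
move=> cv jA cv'; have s0 : 0 < s by apply: leq_ltn_trans (ltn_ord j).
have wle i : weight v i <= weight (incr v j) i.
  by rewrite /weight ffunE leq_add2r leq_mul2r leq_addr orbT.
have cA' : #|A'| = #|A| by rewrite (cell_card cv') (cell_card cv).
have [->|ne] := eqVneq A' A.
  rewrite !(bigD1 j jA) /= -addSn leq_add //; last by apply: leq_sum.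
  by rewrite /weight ffunE eqxx mulnDl mul1n; lia.
apply: leq_trans (lowest_weight_lt (cell_lowest cv) cA' ne) _.
by apply: leq_sum.
Qed.

(* The pairs (A, v) are listed by decreasing total weight of v on A.  The last two clauses
   make the colon ideal of v, modulo the predecessors of (A, v), equal to the ideal of the
   variables in A. *)
Lemma cell_generators c : c <= s -> exists vs : seq ({set 'I_s} * exponent),
  [/\ forall p, p \in vs -> cell c p.2 p.1,
      forall k, small_deficits c k -> ~ small_deficits c.+1 k ->
        exists2 p, p \in vs & le_exp p.2 k,
      forall us p us' j, vs = us ++ p :: us' -> j \in p.1 ->
        ~ small_deficits c.+1 (incr p.2 j) ->
        exists2 q, q \in us & le_exp q.2 (incr p.2 j) &
      forall us p us' q, vs = us ++ p :: us' -> q \in us ->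
        exists2 i, i \in p.1 & p.2 i < q.2 i].
Proof.
move=> cs; pose is_gen (p : {set 'I_s} * exponent) := cell c p.2 p.1 /\ p.2 = cell_gen p.1 p.2.
pose all_pairs := [seq (A, [ffun i => (u i : nat)] : exponent) |
   A : {set 'I_s} <- enum {: {set 'I_s}},
   u : {ffun 'I_s -> 'I_beta.+1} <- enum {: {ffun 'I_s -> 'I_beta.+1}}].
pose key (p : {set 'I_s} * exponent) := \sum_(i in p.1) weight p.2 i.
pose r p q := key q <= key p.
pose vs := sort r (undup [seq p <- all_pairs | `[< is_gen p >]]).
have memvs p : p \in vs <-> is_gen p.
  rewrite mem_sort mem_undup mem_filter; split=> [/andP[/asboolP]//|gp].
  apply/andP; split; first exact/asboolP.
  case: p gp => A v [/= cv ev]; have vb := cell_gen_bound cv ev.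
  apply/allpairsP; exists (A, [ffun i => inord (v i)]); rewrite /= !mem_enum; split => //.
  by congr (_, _); apply/ffunP => i; rewrite !ffunE inordK // ltnS.
have gen_vs k A : cell c k A -> (A, cell_gen A k) \in vs.
  by move=> ck; apply/memvs; split; [exact: cell_gen_cell|rewrite cell_gen_id].
have rtr : transitive r by move=> q p t pq qt; apply: leq_trans qt pq.
have pw us p us' : vs = us ++ p :: us' -> [/\ uniq (us ++ p :: us'),
    (forall q, q \in us -> r q p) & (forall q, q \in us' -> r p q)].
  move=> evs; have uvs : uniq vs by rewrite sort_uniq undup_uniq.
  have : pairwise r vs by rewrite -sorted_pairwise // sort_sorted // => x y; apply: leq_total.
  rewrite evs pairwise_cat => /and3P[/allrelP rel _ /= /andP[/allP rp _]]; split.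
  - by rewrite -evs.
  - by move=> q qus; apply: rel => //; apply: mem_head.
  - exact: rp.
exists vs; split.
- by move=> p /memvs[].
- move=> k sk nsk; have [A ck] := cell_exists cs sk nsk.
  by exists (A, cell_gen A k); [exact: gen_vs|exact: cell_gen_le ck].
- move=> us p us' j evs jp nsk; have [_ _ rp] := pw _ _ _ evs.
  have /memvs[cp ep] : p \in vs by rewrite evs mem_cat mem_head orbT.
  have [|A ck] := cell_exists cs _ nsk.
    by apply: small_deficits_le (cell_small cp) => i; rewrite ffunE leq_addr.
  pose q := (A, cell_gen A (incr p.2 j)).
  have lt : key p < key q.
    apply: leq_trans (cell_incr_weight cp jp ck) _.
    by apply: leq_sum => i iA; rewrite cell_gen_weight.
  exists q; last exact: cell_gen_le ck.
  have := gen_vs _ _ ck; rewrite evs mem_cat in_cons -/q => /or3P[//|/eqP eq|/rp].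
    by rewrite eq ltnn in lt.
  by rewrite /r leqNgt lt.
move=> us p us' q evs qus; have [uvs rq _] := pw _ _ _ evs.
have /memvs[cp ep] : p \in vs by rewrite evs mem_cat mem_head orbT.
have /memvs[cq eq] : q \in vs by rewrite evs mem_cat qus.
(* Otherwise q is at most p on [p.1], and [key q] <= weight of q on [p.1] <= [key p] <= [key q]
   forces [p.1 = q.1], then equality on it, hence [p = q], against uniqueness. *)
apply: contrapT => H.
have le i : i \in p.1 -> q.2 i <= p.2 i.
  by move=> ip; rewrite leqNgt; apply/negP => lt; apply: H; exists i.
have wle : \sum_(i in p.1) weight q.2 i <= key p.
  by apply: leq_sum => i ip; rewrite /weight leq_add2r leq_mul2r le // orbT.
have c12 : #|p.1| = #|q.1| by rewrite (cell_card cp) (cell_card cq).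
have e12 : p.1 = q.1.
  apply/eqP/negPn/negP => ne; have := lowest_weight_lt (cell_lowest cq) c12 ne.
  by rewrite ltnNge (leq_trans wle (rq _ qus)).
have e2 i : i \in p.1 -> q.2 i = p.2 i.
  move=> ip; apply/eqP; rewrite eqn_leq le //= leqNgt; apply/negP => lt.
  suff : key q < key p by move: (rq _ qus); rewrite /r leqNgt => /negPf->.
  rewrite /key -e12 !(bigD1 i ip) /= -addSn leq_add //.
    rewrite /weight -addSn leq_add2r; apply: leq_trans (leq_mul lt (leqnn s)).
    by rewrite mulSn; have := ltn_ord i; lia.
  by apply: leq_sum => l /andP[lp _]; rewrite /weight leq_add2r leq_mul2r le // orbT.
have e22 : p.2 = q.2.
  by rewrite ep eq e12; apply: eq_cell_gen => i iq; rewrite e2 ?e12.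
have epq : p = q by rewrite [p]surjective_pairing e12 e22 -surjective_pairing.
by move: uvs; rewrite cat_uniq => /and3P[_ /hasPn /(_ p (mem_head _ _))]; rewrite epq qus.
Qed.

End Exponents.

(** * Arithmetic of exponents: witnesses, splitting and division *)

Section ExponentArithmetic.
Variable s : nat.
Local Notation exponent := {ffun 'I_s -> nat}.
Implicit Types (k v w : exponent) (A B : {set 'I_s}).
Local Open Scope nat_scope.

Definition decr k (j : 'I_s) : exponent := [ffun i => k i - (i == j)].

Lemma sum_decr A k j : j \in A -> 0 < k j -> (\sum_(i in A) decr k j i).+1 = \sum_(i in A) k i.
Proof.
move=> jA kj; rewrite !(bigD1 j jA) /= ffunE eqxx subn1 -addSn prednK //.
by congr (_ + _); apply: eq_bigr => i /andP[_ /negPf ij]; rewrite ffunE ij subn0.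
Qed.

Lemma exponent_between A k v T : le_exp k v ->
  \sum_(i in A) k i <= T <= \sum_(i in A) v i ->
  exists w, [/\ le_exp k w, le_exp w v & \sum_(i in A) w i = T].
Proof.
move En : (\sum_(i in A) v i - T) => n; elim: n v En => [|n IH] v En kv /andP[kT Tv].
  by exists v; split => //; apply/eqP; rewrite eqn_leq Tv -subn_eq0 En.
have [j jA kvj] : exists2 j, j \in A & k j < v j.
  apply: contrapT => H; have : \sum_(i in A) v i <= \sum_(i in A) k i; last by lia.
  by apply: leq_sum => i iA; rewrite leqNgt; apply/negP => lt; apply: H; exists i.
have eS := sum_decr jA (leq_ltn_trans (leq0n _) kvj).
have [||| w [kw wv eT]] := IH (decr v j).
- lia.
- move=> i; rewrite ffunE; have := kv i; case: eqP => [->|_] /=; lia.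
- lia.
by exists w; split => // i; apply: leq_trans (wv i) _; rewrite ffunE leq_subr.
Qed.

(** The deficit D + 1 is spread over A with at least 1 and at most [beta] at each index. The
    resulting exponent just misses the bound on A; it shows strata to be nonzero and realizes
    [var_ideal] as a colon ideal. *)
Lemma cell_witness beta D A : #|A| <= D.+1 <= #|A| * beta ->
  exists v, [/\ deficit beta A v = D.+1, forall i, i \notin A -> v i = beta &
    forall i, i \in A -> v i < beta].
Proof.
move=> /andP[cD Db].
have [b0|b0] := posnP beta; first by rewrite b0 muln0 in Db.
have [||u [lo hi eS]] := @exponent_between A [ffun=> 1] [ffun=> beta] D.+1.
- by move=> i; rewrite !ffunE.
- rewrite (eq_bigr (fun=> 1)) => [|i _]; last by rewrite ffunE.
  rewrite [X in _ && (_ <= X)](eq_bigr (fun=> beta)) => [|i _]; last by rewrite ffunE.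
  by rewrite !sum_nat_const muln1 cD.
exists [ffun i => if i \in A then beta - u i else beta]; split.
- rewrite -eS; apply: eq_bigr => i iA; rewrite ffunE iA subKn //.
  by have := hi i; rewrite ffunE.
- by move=> i /negPf iA; rewrite ffunE iA.
- by move=> i iA; have := lo i; rewrite !ffunE iA; lia.
Qed.

Lemma deficit_setI beta A B v : (forall i, i \notin A -> v i = beta) ->
  deficit beta B v = deficit beta (A :&: B) v.
Proof.
move=> vA; rewrite /deficit (big_setID A) /= finset.setIC [X in _ + X]big1 ?addn0 // => i.
by rewrite inE => /andP[iA _]; rewrite vA // subnn.
Qed.

Lemma cell_witness_small beta D A v B : deficit beta A v = D.+1 ->
  (forall i, i \notin A -> v i = beta) -> (forall i, i \in A -> v i < beta) ->
  #|B| < #|A| -> deficit beta B v <= D.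
Proof.
move=> dA vA lA cBA; rewrite (deficit_setI _ vA) -ltnS -dA.
have [j jA jB] : exists2 j, j \in A & j \notin B.
  by apply/fintype.subsetPn; apply: contraTN cBA => /subset_leq_card; rewrite leqNgt.
rewrite /deficit [X in _ < X](big_setID B) /= -[X in X < _]addn0 ltn_add2l.
by rewrite (bigD1 j) ?inE ?jA ?jB //= addn_gt0 subn_gt0 lA.
Qed.

Lemma cell_witness_incr beta D A v B j : deficit beta A v = D.+1 ->
  (forall i, i \notin A -> v i = beta) -> (forall i, i \in A -> v i < beta) ->
  j \in A -> deficit beta B (incr v j) <= D.
Proof.
move=> dA vA lA jA; apply: (@leq_trans (deficit beta A (incr v j))).
  rewrite /deficit (big_setID A) /= [X in _ + X]big1 ?addn0 => [|i]; last first.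
    by rewrite inE => /andP[/vA vi _]; rewrite ffunE vi; lia.
  by rewrite finset.setIC; apply: (deficit_sub beta (incr v j)); apply: subsetIl.
rewrite -ltnS -dA /deficit !(bigD1 j jA) /= ffunE eqxx -addSn leq_add //.
  by have := lA j jA; lia.
by apply: leq_sum => i _; rewrite ffunE; lia.
Qed.

(* Balanced splitting of a total deficit: the first part takes the increments of the
   partial sums divided by m.+1. *)
Lemma exponent_split b e m k : \sum_i (m.+1 * b - k i) <= m.+1 * e ->
  exists k1 k2 : exponent, [/\ forall i, k1 i + k2 i <= k i,
    \sum_i (b - k1 i) <= e & \sum_i (m * b - k2 i) <= m * e].
Proof.
pose d (i : 'I_s) := m.+1 * b - k i; pose S (p : nat) := \sum_(j < s | j < p) d j.
have SS (i : 'I_s) : S i.+1 = d i + S i.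
  rewrite /S (bigD1 i) //=; congr (_ + _); apply: eq_bigl => j.
  by rewrite ltnS ltn_neqAle andbC.
pose t (p : nat) := S p %/ m.+1.
pose d1 (i : 'I_s) := t i.+1 - t i.
have divle (i : 'I_s) : d i <= m.+1 * b by rewrite leq_subr.
have d1P (i : 'I_s) : [/\ t i <= t i.+1, d1 i <= b, d1 i <= d i & d i - d1 i <= m * b].
  rewrite /d1 /t SS; have := divle i; move: (d i) (S i) => x y xb.
  have e1 := divn_eq y m.+1; have e2 := divn_eq (x + y) m.+1.
  have := ltn_pmod y (ltn0Sn m); have := ltn_pmod (x + y) (ltn0Sn m).
  move: (y %/ _) (y %% _) ((x + y) %/ _) ((x + y) %% _) e1 e2 => q r q' r' -> e2 hr' hr.
  have qq' : q <= q' by nia.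
  have : (q' - q) <= b by nia.
  by split => //; nia.
have tS : \sum_i d1 i = (\sum_i d i) %/ m.+1.
  have -> : \sum_i d1 i = \sum_(0 <= i < s) (t i.+1 - t i) by rewrite big_mkord.
  rewrite telescope_sumn_in // => [|p /andP[_ ps]]; last by case: (d1P (Ordinal ps)).
  rewrite /t /S [X in _ - X %/ _]big_pred0 // div0n subn0; congr (_ %/ _).
  by apply: eq_bigl => j; rewrite ltn_ord.
rewrite -/(\sum_i d i) => le.
exists [ffun i => b - d1 i], [ffun i => m * b - (d i - d1 i)]; split.
- move=> i; rewrite !ffunE; have [_ h1 h2 h3] := d1P i.
  by move: h1 h2 h3; rewrite /d mulSn; lia.
- under eq_bigr => i _ do [rewrite ffunE subKn; last by case: (d1P i)].
  by rewrite tS; apply: leq_trans (leq_div2r _ le) _; rewrite mulKn.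
- under eq_bigr => i _ do [rewrite ffunE subKn; last by case: (d1P i)].
  have -> : \sum_i (d i - d1 i) = \sum_i d i - \sum_i d1 i.
    by rewrite sumnB // => i _; case: (d1P i).
  rewrite tS; move: (\sum_i d i) le => x le.
  by have e1 := divn_eq x m.+1; have := ltn_pmod x (ltn0Sn m); nia.
Qed.

(** An entry below b outside the h lowest ones would force all h of these below b, with deficit at
    least h. *)
Lemma total_deficit b h k : 0 < h -> h <= s -> small_deficits b h.-1 h.+1 k ->
  \sum_i (b - k i) <= h.-1.
Proof.
move=> h0 hs sk; have [A cA lA] := lowest_exists k hs.
have dA : deficit b A k <= h.-1 by apply: sk; rewrite cA.
apply: leq_trans dA; rewrite /deficit (bigID (mem A)) /= [X in _ + X]big1 ?addn0 // => i iA.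
apply/eqP; rewrite subn_eq0 leqNgt; apply/negP => kib.
have : h <= deficit b A k.
  rewrite -cA -sum1_card; apply: leq_sum => j jA.
  by have := weight_lt_leq (lA i j iA jA); rewrite subn_gt0 => /leq_ltn_trans; apply.
by have := sk A; rewrite cA ltnSn => /(_ isT); lia.
Qed.

Lemma exponent_truncate b a k : a <= b * s -> \sum_i (b - k i) <= b * s - a ->
  exists w, [/\ le_exp w k, forall i, w i <= b & \sum_i w i = a].
Proof.
move=> abs le; have eS : \sum_(i < s) minn (k i) b + \sum_i (b - k i) = b * s.
  rewrite -big_split /= (eq_bigr (fun=> b)) => [|i _]; last by lia.
  by rewrite sum_nat_const card_ord mulnC.
have [||w [_ wk eS']] := @exponent_between finset.setT [ffun=> 0] [ffun i => minn (k i) b] a.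
- by move=> i; rewrite ffunE.
- rewrite big1 => [|i _]; last by rewrite ffunE.
  have -> : \sum_(i in finset.setT) [ffun i => minn (k i) b] i = \sum_(i < s) minn (k i) b.
    by apply: eq_big => [i|i _]; rewrite ?inE ?ffunE.
  by move: (\sum_(i < s) minn _ _) eS => x eS; lia.
exists w; split => [i|i|].
- by apply: leq_trans (wk i) _; rewrite ffunE geq_minl.
- by apply: leq_trans (wk i) _; rewrite ffunE geq_minr.
- by rewrite -eS'; apply: eq_bigl => i; rewrite inE.
Qed.

(** Lowering an entry by one raises each deficit by at most one, so the bound survives until some
    h-set attains it; the zero exponent is never reached, as its deficit h [beta] exceeds D. *)
Lemma small_deficits_tight beta D h w : h <= s -> D < h * beta -> 
  (forall i, w i <= beta) -> small_deficits beta D h.+1 w ->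
  exists w' A, [/\ le_exp w' w, small_deficits beta D h.+1 w', #|A| = h &
    deficit beta A w' = D].
Proof.
move=> hs Dhb; move En : (\sum_i w i) => n; elim: n w En => [|n IH] w En wb sw.
  have w0 i : w i = 0.
    by apply/eqP; move/eqP: En; rewrite sum_nat_eq0 => /forallP/(_ i).
  have [A cA _] := lowest_exists w hs.
  have := sw A; rewrite cA ltnSn => /(_ isT); rewrite /deficit.
  under eq_bigr => i _ do rewrite w0 subn0.
  by rewrite sum_nat_const cA; lia.
have [[A cA dA]|H] := pselect (exists2 A : {set 'I_s}, #|A| = h & deficit beta A w = D).
  by exists w, A; split => // i.
have [j wj] : exists j, 0 < w j.
  apply: contrapT => H'; have : \sum_i w i = 0; last by rewrite En.
  by apply: big1 => i _; apply/eqP; rewrite -leqn0 leqNgt; apply/negP => wi; apply: H'; exists i.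
have [|i|B|w' [A [w'w sw' cA dA]]] := IH (decr w j).
- have := @sum_decr finset.setT w j; rewrite inE => /(_ isT wj).
  have e v : \sum_(i in finset.setT) v i = \sum_i v i by apply: eq_bigl => i; rewrite inE.
  by rewrite !e En => -[].
- by rewrite ffunE; apply: leq_trans (leq_subr _ _) (wb i).
- rewrite ltnS => cB; have [A cA lA] := lowest_exists (decr w j) hs.
  apply: leq_trans (lowest_deficit _ lA (_ : #|B| <= #|A|)) _; first by rewrite cA.
  have lt : deficit beta A w < D.
    rewrite ltn_neqAle sw ?cA // andbT; apply/eqP => e; apply: H; by exists A.
  apply: leq_trans lt; rewrite /deficit -add1n.
  have [jA|jA] := boolP (j \in A).
    rewrite !(bigD1 j jA) /= ffunE eqxx addnA leq_add //; first by lia.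
    by apply: leq_sum => i /andP[_ /negPf ij]; rewrite ffunE ij; lia.
  rewrite leqW //; apply: leq_sum => i iA; rewrite ffunE; case: eqP => [ij|]; last by lia.
  by rewrite -ij iA in jA.
exists w', A; split => // i; apply: leq_trans (w'w i) _.
by rewrite ffunE leq_subr.
Qed.

(** Rounding k_i / l down loses at most h (l - 1) in total on [B']; q absorbs (h - 1)(l - 1) of it,
    and the remaining l - 1 disappears on dividing by l. *)
Lemma small_deficits_div b h m l q k : 0 < h -> 0 < b -> 0 < m -> 0 < l ->
  (l - 1) * (h - 1) <= q ->
  small_deficits ((l * m + q) * b) ((l * m + q) * (h - 1)) h.+1 k ->
  small_deficits (m * b) (m * (h - 1)) h.+1 [ffun i => minn (k i %/ l) (m * b)].
Proof.
move=> h0 b0 m0 l0 hq sk B cB.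
pose B' := [set i in B | k i %/ l < m * b].
have cB' : #|B'| <= h.
  by rewrite -ltnS (leq_ltn_trans _ cB) //; apply/subset_leq_card/fintype.subsetP => i; rewrite inE => /andP[].
have -> : deficit (m * b) B [ffun i => minn (k i %/ l) (m * b)] =
    \sum_(i in B') (m * b - k i %/ l).
  rewrite /deficit (bigID (fun i => k i %/ l < m * b)) /= [X in _ + X]big1 ?addn0 => [|i].
    apply: eq_big => [i|i /andP[_ lt]]; first by rewrite inE.
    by rewrite ffunE; congr (_ - _); lia.
  by move=> /andP[_ ge]; rewrite ffunE; lia.
have eS : \sum_(i in B') (m * b - k i %/ l) + \sum_(i in B') k i %/ l = #|B'| * (m * b).
  rewrite -big_split /= -sum_nat_const; apply: eq_bigr => i.
  by rewrite inE => /andP[_ lt]; lia.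
have sk' : #|B'| * ((l * m + q) * b) <= (l * m + q) * (h - 1) + \sum_(i in B') k i.
  have := sk B'; rewrite ltnS => /(_ cB'); rewrite /deficit => le.
  apply: leq_trans (leq_add le (leqnn _)); rewrite -big_split /= -sum_nat_const.
  by apply: leq_sum => i _; lia.
have dv : \sum_(i in B') k i <= l * \sum_(i in B') k i %/ l + #|B'| * (l - 1).
  rewrite big_distrr /= -sum_nat_const -big_split /=; apply: leq_sum => i _.
  by have := divn_eq (k i) l; have := ltn_pmod (k i) l0; lia.
move: (\sum_(i in B') k i) (\sum_(i in B') k i %/ l) (\sum_(i in B') _) #|B'| cB' eS sk' dv.
move=> x y z c ch ez hx hy.
(* If c b <= h - 1, the deficit of c entries is at most m (h - 1) anyway; otherwise E + 1 is the
   excess of c b over h - 1. *)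
have [le|gt] := leqP (c * b) (h - 1).
  have : m * (c * b) <= m * (h - 1) by rewrite leq_mul2l le orbT.
  by rewrite mulnCA in ez; lia.
have [E eE] : exists E, c * b = (h - 1) + E.+1 by exists (c * b - h); lia.
suff : m * E.+1 <= y by nia.
have h1 : (l * m + q) * E.+1 <= x by nia.
have h2 : q + l * m * E.+1 <= (l * m + q) * E.+1 by nia.
have h3 : c * (l - 1) <= (l - 1) * (h - 1) + (l - 1) by nia.
have h4 : l * (m * E.+1) <= l * y + (l - 1) by rewrite mulnA; lia.
rewrite leqNgt; apply/negP => lt; have : l * y.+1 <= l * (m * E.+1) by rewrite leq_mul2l lt orbT.
by rewrite mulnS; lia.
Qed.

(** On the h-set A where w is tight, the sum of w is exactly m (bh - (h - 1)), while that of k is at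
    least (lm + q)(bh - (h - 1)). *)
Lemma small_deficits_containment b h m l q k : h <= s -> 0 < h -> 0 < b -> 0 < m -> 0 < l ->
  (l - 1) * (h - 1) <= q ->
  small_deficits ((l * m + q) * b) ((l * m + q) * (h - 1)) h.+1 k ->
  exists w, [/\ small_deficits (m * b) (m * (h - 1)) h.+1 w,
    forall i, l * w i <= k i & q * (b * h - (h - 1)) <= \sum_i (k i - l * w i)].
Proof.
move=> hs h0 b0 m0 l0 hq sk; have sw := small_deficits_div h0 b0 m0 l0 hq sk.
have [||w [A [ww sw' cA dA]]] := small_deficits_tight hs _ _ sw.
- by have := leq_mul m0 b0; nia.
- by move=> i; rewrite ffunE geq_minr.
have wk i : l * w i <= k i.
  apply: leq_trans (leq_mul (leqnn l) (ww i)) _; rewrite ffunE.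
  apply: leq_trans (leq_mul (leqnn l) (geq_minl _ _)) _.
  by rewrite mulnC leq_divM.
exists w; split => //.
apply: (@leq_trans (\sum_(i in A) (k i - l * w i))); last first.
  by rewrite [X in _ <= X](bigID (mem A)) /= leq_addr.
have wb i : w i <= m * b by apply: leq_trans (ww i) _; rewrite ffunE geq_minr.
have eA : m * (h - 1) + \sum_(i in A) w i = h * (m * b).
  rewrite -dA /deficit -big_split /= -cA -sum_nat_const; apply: eq_bigr => i _.
  by have := wb i; lia.
have eK : \sum_(i in A) (k i - l * w i) + l * \sum_(i in A) w i = \sum_(i in A) k i.
  rewrite big_distrr /= -big_split /=; apply: eq_bigr => i _.
  by have := wk i; lia.
have hK : h * ((l * m + q) * b) <= (l * m + q) * (h - 1) + \sum_(i in A) k i.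
  have := sk A; rewrite cA ltnSn => /(_ isT); rewrite /deficit => le.
  apply: leq_trans (leq_add le (leqnn _)); rewrite -big_split /= -cA -sum_nat_const.
  by apply: leq_sum => i _; lia.
move: (\sum_(i in A) (k i - _)) (\sum_(i in A) w i) (\sum_(i in A) k i) eA eK hK => x y z eA eK hK.
have [t et] : exists t, b * h = (h - 1) + t by exists (b * h - (h - 1)); nia.
rewrite et addKn; have ey : y = m * t by nia.
by nia.
Qed.

End ExponentArithmetic.

(** * Monomials in generic forms *)

Section MonomialsInForms.
Variables (K : fieldType) (n s d h : nat) (f : 'I_s -> {mpoly K[n]}).
Local Notation R := {mpoly K[n]}.
Local Notation exponent := {ffun 'I_s -> nat}.
Implicit Types (k v a : exponent) (A B : {set 'I_s}) (G Q : set R).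
Hypotheses (d_gt0 : (0 < d)%N) (homog_f : forall i, f i \is d.-homog).
Hypothesis generic_f : c_generic h f.

Definition mon k : R := \prod_i f i ^+ k i.

Definition pow_ideal A a : set R := ext [set 0] [seq f i ^+ a i | i <- enum A].

Definition var_ideal A : set R := ext [set 0] [seq f i | i <- enum A].

Definition mon_ideal (S : exponent -> Prop) : set R :=
  ideal_gen [set g | exists2 k, S k & g = mon k].

Lemma posform_f i : posform (f i). Proof. by exists d. Qed.

Lemma is_ideal_pow A a : is_ideal (pow_ideal A a). Proof. exact: ideal_ext. Qed.
Lemma is_ideal_var A : is_ideal (var_ideal A). Proof. exact: ideal_ext. Qed.
Lemma is_ideal_mon S : is_ideal (mon_ideal S). Proof. exact: is_ideal_gen. Qed.
Hint Resolve is_ideal_pow is_ideal_var is_ideal_mon : core.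

Lemma mem_mon_ideal (S : exponent -> Prop) k : S k -> mon_ideal S (mon k).
Proof. by move=> Sk; apply: ideal_gen_sub; exists k. Qed.

Lemma mon_ideal_min (S : exponent -> Prop) Q : is_ideal Q ->
  (forall k, S k -> Q (mon k)) -> mon_ideal S `<=` Q.
Proof. by move=> idQ SQ; apply: ideal_gen_min => // _ [k Sk ->]; apply: SQ. Qed.

Lemma mon_ideal_sub (S S' : exponent -> Prop) : (forall k, S k -> S' k) ->
  mon_ideal S `<=` mon_ideal S'.
Proof. by move=> SS'; apply: mon_ideal_min => // k /SS'; apply: mem_mon_ideal. Qed.

Lemma mon_homog k : mon k \is (d * \sum_i k i).-homog.
Proof.
rewrite /mon big_distrr /=; elim/big_rec2: _ => [|i e x _ hx]; first exact: dhomog1.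
by apply: dhomogM => //; apply: dhomogMn.
Qed.

Lemma homog_mon_ideal S : homog_ideal (mon_ideal S).
Proof. by apply: homog_ideal_gen => _ [k _ ->]; exists (d * \sum_i k i)%N; apply: mon_homog. Qed.

Lemma mon_leE k v : le_exp k v -> mon v = mon [ffun i => v i - k i]%N * mon k.
Proof.
move=> kv; rewrite -big_split; apply: eq_bigr => i _ /=.
by rewrite ffunE -exprD subnK.
Qed.

Lemma mon_incr v j : mon (incr v j) = f j * mon v.
Proof.
rewrite (@mon_leE v) => [|i]; last by rewrite ffunE leq_addr.
congr (_ * _); rewrite /mon (bigD1 j) //= !ffunE eqxx addKn expr1.
by rewrite big1 ?mulr1 // => i /negPf ij; rewrite !ffunE ij addn0 subnn.
Qed.

Lemma mem_mon_le Q k v : is_ideal Q -> le_exp k v -> Q (mon k) -> Q (mon v).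
Proof. by move=> idQ kv Qk; rewrite (mon_leE kv); apply: ideal_mull. Qed.

Lemma mon_pow_ideal A a v j : j \in A -> (a j <= v j)%N -> pow_ideal A a (mon v).
Proof.
move=> jA av; rewrite /mon (bigD1 j) //= -(subnK av) exprD.
apply: ideal_mulr => //; apply: ideal_mull => //; apply: ext_mem => //.
by apply/mapP; exists j; rewrite ?mem_enum.
Qed.

(** An exponent of the level cannot be bounded by v on all of A, where the deficit of v is too
    large. *)
Lemma level_sub_pow_ideal beta D A v c : #|A| = c -> (D < deficit beta A v)%N ->
  mon_ideal (small_deficits beta D c.+1) `<=` pow_ideal A [ffun i => (v i).+1].
Proof.
move=> cA dA; apply: (mon_ideal_min (is_ideal_pow _ _)) => k sk.
have [j jA lt] : exists2 j, j \in A & (v j < k j)%N.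
  apply: contrapT => H; have := sk A; rewrite cA ltnSn => /(_ isT).
  rewrite leqNgt (leq_trans dA) //; apply: deficit_le => j jA.
  by rewrite leqNgt; apply/negP => lt; apply: H; exists j.
by apply: (mon_pow_ideal jA); rewrite ffunE.
Qed.

Lemma pow_ideal_setD1 A a j : j \in A ->
  pow_ideal A a = quo (pow_ideal (A :\ j) a) setT (f j ^+ a j).
Proof.
move=> jA; rewrite /pow_ideal -ext_rcons -map_rcons; apply: eq_ext => //.
apply: eq_mem_map => i; rewrite mem_rcons in_cons !mem_enum !inE.
by case: eqP => [->|].
Qed.

Lemma eq_pow_ideal A a v : (forall i, i \in A -> a i = v i) -> pow_ideal A a = pow_ideal A v.
Proof.
move=> av; rewrite /pow_ideal; congr ext; apply/eq_in_map => i.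
by rewrite mem_enum => /av ->.
Qed.

Lemma var_idealE A : var_ideal A = pow_ideal A [ffun=> 1%N].
Proof. by rewrite /var_ideal /pow_ideal; congr ext; apply: eq_map => i; rewrite ffunE expr1. Qed.

Lemma regular_f A : (#|A| <= h.+1)%N -> wreg setT [set 0] [seq f i | i <- enum A].
Proof. by move=> /generic_f/regular_seqE[]. Qed.

(** Together with i there are at most h + 1 indices, so genericity applies; rotation moves f_i to
    the end of the sequence. *)
Lemma nzd_var_ideal A i : (#|A| <= h)%N -> i \notin A -> nzd (var_ideal A) (f i).
Proof.
move=> cA iA; have /regular_f : (#|i |: A| <= h.+1)%N by rewrite cardsU1 iA.
have iB : i \in enum (i |: A) by rewrite mem_enum setU11.
have [s1 [s2 eB]] : exists s1 s2, enum (i |: A) = s1 ++ i :: s2.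
  by case/splitPr: iB => s1 s2; exists s1, s2.
rewrite eB map_cat => /wreg_cat[_]; rewrite lend_setT /=.
move=> /wreg_rot/wreg_rcons[||x|_ nf] //.
- by apply: homog_ideal_ext; [exact: homog_ideal_zero|move=> x /mapP[j _ ->]; exact: posform_f].
- exact: posform_f.
- by move=> /mapP[j _ ->]; exact: posform_f.
move: nf; rewrite -ext_cat -map_cat (_ : ext _ _ = var_ideal A) //.
apply: eq_ext => //; apply: eq_mem_map => j; rewrite mem_cat mem_enum.
have : uniq (enum (i |: A)) by apply: enum_uniq.
have := mem_enum (i |: A) j; rewrite eB mem_cat in_cons !inE.
rewrite cat_uniq /= => ej /and3P[_ /norP[is1 _] /andP[is2 _]].
have [eji|ne] := eqVneq j i; last by move: ej; rewrite (negPf ne).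
by rewrite eji (negPf is1) (negPf is2) (negPf iA).
Qed.

(** Induction on the total exponent: f_j^(a_j) is f_j times f_j^(a_j - 1), and [nzd_quoM] leads to
    smaller exponents. *)
Lemma nzd_pow_ideal A a i : (#|A| <= h)%N -> i \notin A -> nzd (pow_ideal A a) (f i).
Proof.
move eN : (\sum_(j in A) a j)%N => N; elim/ltn_ind: N A a i eN => N IH A a i eN cA iA.
have sumD j : j \in A -> N = (a j + \sum_(l in A :\ j) a l)%N.
  by move=> jA; rewrite -eN (big_setD1 j).
have [[j jA aj]|H] := pselect (exists2 j, j \in A & (1 < a j)%N); last first.
  (* No exponent exceeds 1 here: a zero exponent gives the unit ideal, otherwise all are 1. *)
  have [[j jA aj]|H'] := pselect (exists2 j, j \in A & a j = 0%N).
    have one : pow_ideal A a 1.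
      by apply: ext_mem => //; apply/mapP; exists j; rewrite ?mem_enum ?aj ?expr0.
    by move=> z _; rewrite -[z]mulr1; apply: ideal_mull.
  rewrite (_ : pow_ideal A a = var_ideal A); first exact: nzd_var_ideal.
  rewrite var_idealE; apply: eq_pow_ideal => j jA; rewrite ffunE; apply/eqP.
  rewrite eqn_leq leqNgt lt0n; apply/andP; split; first by apply/negP => aj; apply: H; exists j.
  by apply/eqP => aj; apply: H'; exists j.
pose upd t : exponent := [ffun l => if l == j then t else a l].
have cAj : (#|A :\ j| <= h)%N by apply: leq_trans cA; apply/subset_leq_card/subD1set.
have updE t : pow_ideal A (upd t) = quo (pow_ideal (A :\ j) a) setT (f j ^+ t).
  rewrite (pow_ideal_setD1 _ jA) ffunE eqxx (@eq_pow_ideal _ _ a) // => l.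
  by rewrite !inE ffunE => /andP[/negPf->].
have IHupd t : (t < a j)%N -> nzd (pow_ideal A (upd t)) (f i).
  move=> ta; apply: (IH _ _ _ _ _ (erefl _)) => //.
  rewrite (big_setD1 j) //= ffunE eqxx (sumD j jA) -addSn leq_add // leq_eqVlt; apply/orP; left.
  apply/eqP/eq_bigr => l; by rewrite !inE ffunE => /andP[/negPf->].
rewrite (pow_ideal_setD1 _ jA) -(prednK (ltnW aj)) exprS; apply: nzd_quoM => //.
- apply: (IH _ _ _ _ _ (erefl _)) => //; last by rewrite !inE eqxx.
  by rewrite (sumD j jA) -[X in (X < _)%N]add0n ltn_add2r ltnW.
- by rewrite -[f j]expr1 -updE; apply: IHupd.
- by rewrite -updE; apply: IHupd; rewrite ltn_predL ltnW.
Qed.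

(** The forms outside A are nonzerodivisors and cancel from [mon v]. Inside A the powers f_j^(v_j)
    are removed one index at a time, each removal lowering the exponent v_j + 1 in the ideal to
    1. *)
Lemma pow_ideal_colon A v z : (#|A| <= h)%N ->
  pow_ideal A [ffun i => (v i).+1] (mon v * z) -> var_ideal A z.
Proof.
move=> cA; rewrite /mon (bigID (mem A)) /=.
have nzd_out : nzd (pow_ideal A [ffun i => (v i).+1]) (\prod_(i | i \notin A) f i ^+ v i).
  apply: (big_ind (nzd _)) => [w|x y|i iA]; first by rewrite mul1r.
    exact: nzdM.
  by apply: nzdX => //; apply: nzd_pow_ideal.
rewrite [X in X * z]mulrC -mulrA => /nzd_out {nzd_out}.
pose ex (X : {set 'I_s}) : exponent := [ffun i => if i \in X then (v i).+1 else 1%N].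
suff H N (X : {set 'I_s}) : #|X| = N -> X \subset A ->
    pow_ideal A (ex X) ((\prod_(i in X) f i ^+ v i) * z) -> var_ideal A z.
  rewrite (@eq_pow_ideal _ _ (ex A)) => [|i iA]; last by rewrite !ffunE iA.
  exact: (H _ A (erefl _)).
elim: N X => [|N IH] X cX XA.
  move/eqP: cX; rewrite cards_eq0 => /eqP->; rewrite big_set0 mul1r var_idealE.
  by rewrite (@eq_pow_ideal _ _ [ffun=> 1%N]) // => i _; rewrite !ffunE inE.
have [j jX] : exists j, j \in X by apply/set0Pn; rewrite -card_gt0 cX.
have jA := fintype.subsetP XA j jX.
have nzj : nzd (pow_ideal (A :\ j) (ex X)) (f j).
  apply: nzd_pow_ideal; last by rewrite !inE eqxx.
  by apply: leq_trans cA; apply/subset_leq_card/subD1set.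
rewrite (pow_ideal_setD1 _ jA) ffunE jX (big_setD1 j) //= -mulrA.
move=> /(colon_powS (is_ideal_pow _ _) nzj) H.
apply: (IH (X :\ j)); first by have := cardsD1 j X; rewrite jX cX add1n => -[].
  exact: fintype.subset_trans (subD1set _ _) XA.
rewrite (pow_ideal_setD1 _ jA) ffunE !inE eqxx /= expr1.
rewrite (@eq_pow_ideal _ _ (ex X)) => [|i]; first exact: H.
by rewrite !ffunE !inE => /andP[-> _].
Qed.

Lemma colon_mon A v G : (#|A| <= h)%N -> is_ideal G ->
  G `<=` pow_ideal A [ffun i => (v i).+1] -> (forall j, j \in A -> G (f j * mon v)) ->
  colon G (mon v) = var_ideal A.
Proof.
move=> cA idG Gpow Gv; apply/seteqP; split=> z.
  by rewrite /colon /= mulrC => /Gpow; apply: pow_ideal_colon.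
apply: (ext_min (ideal_colon _ idG)) => [_ ->|_ /mapP[j + ->]].
  by apply: ideal0; apply: ideal_colon.
by rewrite mem_enum; apply: Gv.
Qed.

Variables (beta D : nat).
Local Notation level c := (mon_ideal (small_deficits beta D c)).

Lemma filtered_level c : (c <= h)%N -> (c <= s)%N ->
  filtered [set P | exists2 A : {set 'I_s}, #|A| = c & P = var_ideal A] (level c.+1) (level c).
Proof.
move=> ch cs; have [vs [cellvs genvs killvs nonvs]] := cell_generators beta D cs.
have -> : level c = ext (level c.+1) [seq mon p.2 | p <- vs].
  apply/seteqP; split; last first.
    apply: ext_min => //; first by apply: mon_ideal_sub => k; apply: small_deficitsS.
    by move=> _ /mapP[p /cellvs[_ _ sp _] ->]; apply: mem_mon_ideal.
  apply: mon_ideal_min => [|k sk]; first exact: ideal_ext.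
  have [sk'|nsk] := pselect (small_deficits beta D c.+1 k).
    by apply: ext_subl => //; apply: mem_mon_ideal.
  have [p pvs pk] := genvs k sk nsk; apply: (mem_mon_le _ pk); first exact: ideal_ext.
  by apply: ext_mem => //; apply: map_f.
suff H us us' : vs = us ++ us' -> filtered [set P | exists2 A : {set 'I_s}, #|A| = c & P = var_ideal A]
    (level c.+1) (ext (level c.+1) [seq mon p.2 | p <- us]).
  by apply: (H vs [::]); rewrite cats0.
elim/last_ind: us us' => [|us p IH] us' evs; first exact: filtered_refl.
rewrite map_rcons ext_rcons; rewrite cat_rcons in evs.
apply: filtered_step; first exact: IH evs.
have [cp lp sp bp] : cell beta D c p.2 p.1.
  by apply: cellvs; rewrite evs mem_cat mem_head orbT.
exists p.1 => //; apply: colon_mon; first by rewrite cp.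
- exact: ideal_ext.
- apply: ext_min => //; first exact: level_sub_pow_ideal cp bp.
  move=> _ /mapP[q qus ->]; have [j jp lt] := nonvs _ _ _ _ evs qus.
  by apply: (mon_pow_ideal jp); rewrite ffunE.
- move=> j jp; rewrite -mon_incr.
  have [sk|nsk] := pselect (small_deficits beta D c.+1 (incr p.2 j)).
    by apply: ext_subl => //; apply: mem_mon_ideal.
  have [q qus le] := killvs _ _ _ _ evs jp nsk.
  apply: (mem_mon_le _ le); first exact: ideal_ext.
  by apply: ext_mem => //; apply: map_f.
Qed.

Lemma level_setT c : (c.-1 * beta <= D)%N -> level c = setT.
Proof.
move=> cD; apply/seteqP; split=> // x _; rewrite -[x]mulr1; apply: ideal_mull (is_ideal_mon _) _.
have -> : 1 = mon [ffun=> 0%N] by rewrite /mon big1 // => i _; rewrite ffunE.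
apply: mem_mon_ideal => B cB; apply: leq_trans cD.
apply: (@leq_trans (#|B| * beta)); last by rewrite leq_mul2r -ltnS (ltn_predK cB) cB orbT.
by rewrite -sum_nat_const; apply: leq_sum => i _; rewrite leq_subr.
Qed.

Lemma filtered_levels c0 : (c0.-1 * beta <= D)%N -> (c0 <= h)%N -> (h <= s)%N ->
  filtered [set P | exists2 A : {set 'I_s}, (c0 <= #|A| <= h)%N & P = var_ideal A] (level h.+1) setT.
Proof.
move=> c0D c0h hs; rewrite -(level_setT c0D).
suff H t : (t <= h.+1 - c0)%N -> filtered [set P | exists2 A : {set 'I_s}, (c0 <= #|A| <= h)%N &
    P = var_ideal A] (level h.+1) (level (h.+1 - t)).
  by have := H (h.+1 - c0)%N (leqnn _); rewrite subKn // ltnW.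
elim: t => [|t IH] le; first by rewrite subn0; apply: filtered_refl.
apply: filtered_trans (IH (ltnW le)) _.
have -> : (h.+1 - t = (h.+1 - t.+1).+1)%N by lia.
apply: filtered_sub (filtered_level _ _); try lia.
by move=> P [A cA ->]; exists A => //; rewrite cA; lia.
Qed.

End MonomialsInForms.

(** * Symbolic powers *)

Section IdealPowers.
Variable R : comNzRingType.
Implicit Types (I J Q G H p : set R).

Lemma mem_ideal_mul I J x y : I x -> J y -> ideal_mul I J (x * y).
Proof. by move=> Ix Jy; apply: ideal_gen_sub; exists x, y. Qed.

Lemma is_ideal_exp I m : is_ideal (ideal_exp I m).
Proof. by case: m => [|m]; [apply: ideal_setT|apply: is_ideal_gen]. Qed.

Lemma ideal_mul_gen G H Q x y : is_ideal Q -> (forall g h, G g -> H h -> Q (g * h)) ->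
  ideal_gen G x -> ideal_gen H y -> Q (x * y).
Proof.
move=> idQ GH Gx Hy; have GHy g : G g -> Q (g * y).
  move=> Gg; rewrite mulrC; apply: (ideal_gen_min (ideal_colon g idQ)) Hy => h Hh.
  by rewrite /colon /= mulrC; apply: GH.
exact: (ideal_gen_min (ideal_colon y idQ)) Gx.
Qed.

Lemma mem_ideal_expX I l x : I x -> ideal_exp I l (x ^+ l).
Proof. by move=> Ix; elim: l => // l IH; rewrite exprS; apply: mem_ideal_mul. Qed.

End IdealPowers.

Lemma clear_denominator (F : fieldType) (u t x y z : F) : u != 0 ->
  u * t * (x / u * y + z) = t * x * y + u * (t * z).
Proof. by move=> u0; field. Qed.

(** A finite sum of fractions has a common denominator outside p, which turns localization into a
    multiplier t. *)
Lemma symb_powE (R : idomainType) (I : set R) m x : symb_pow I m x <->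
  forall p, ass I p -> exists2 t, ~ p t & ideal_exp I m (t * x).
Proof.
have idm := is_ideal_exp I m; split=> H p ap; have [[idp p1 pM] _] := ap.
  have [ts [tsP ex]] := H p ap.
  suff [t npt [y Iy ey]] : exists2 t, ~ p t & exists2 y, ideal_exp I m y &
      tofrac t * tofrac x = tofrac y.
    exists t => //; suff -> : t * x = y by [].
    by apply/eqP; rewrite -tofrac_eq tofracM ey.
  rewrite {}ex; elim: ts tsP => [|c ts IH] tsP.
    by exists 1 => //; exists 0; [exact: ideal0|rewrite big_nil mulr0 tofrac0].
  have [c' c'ts|t npt [y Iy ey]] := IH; first by apply: tsP; rewrite in_cons c'ts orbT.
  have [[aa [u [npu ec]]] Ic] := tsP c (mem_head _ _).
  have u0 : u != 0 by apply/eqP => u0; apply: npu; rewrite u0; exact: ideal0.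
  exists (u * t); first by case/pM.
  exists (t * aa * c.2 + u * y).
    by apply: idealD => //; apply: ideal_mull.
  have {}u0 : tofrac u != 0 by rewrite tofrac_eq0.
  rewrite big_cons ec !(tofracD, tofracM) -ey.
  exact: clear_denominator.
have [t npt It] := H p ap; exists [:: ((tofrac t)^-1, t * x)]; split.
  move=> c; rewrite inE => /eqP -> /=; split => //.
  by exists 1, t; rewrite tofrac1 mul1r.
have t0 : t != 0 by apply/eqP => t0; apply: npt; rewrite t0; exact: ideal0.
by rewrite big_seq1 /= tofracM mulKf // tofrac_eq0.
Qed.

Lemma is_ideal_symb_pow (R : idomainType) (I : set R) m : is_ideal (symb_pow I m).
Proof.
have idm := is_ideal_exp I m; split.
- by apply/symb_powE => p [[idp p1 _] _]; exists 1 => //; rewrite mulr0; apply: ideal0.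
- move=> x y /symb_powE Hx /symb_powE Hy; apply/symb_powE => p ap.
  have [t npt Itx] := Hx p ap; have [u npu Iuy] := Hy p ap.
  have [[_ _ pM] _] := ap; exists (t * u); first by case/pM.
  rewrite mulrDr (mulrAC t u x) -(mulrA t u y); apply: idealD => //.
    exact: ideal_mulr.
  exact: ideal_mull.
- move=> r x /symb_powE Hx; apply/symb_powE => p ap.
  by have [t npt Itx] := Hx p ap; exists t => //; rewrite mulrCA; apply: ideal_mull.
Qed.

(** * Powers of the maximal ideal and initial degrees *)

Section Alpha.
Variables (K : fieldType) (n : nat).
Local Notation R := {mpoly K[n]}.

Lemma homog_mem_max_exp (g : R) t e : g \is t.-homog -> (e <= t)%N ->
  ideal_exp (max_ideal K n) e g.
Proof.
move=> hg et; have idm := is_ideal_exp (max_ideal K n).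
have Xm (m : 'X_{1..n}) : (e <= mdeg m)%N -> ideal_exp (max_ideal K n) e 'X_[m].
  elim: e {et} m => // e IH m em.
  have [i mi] : exists i, m i != 0%N.
    apply: contrapT => H; have : mdeg m = 0%N; last by move: em; case: (mdeg m).
    rewrite mdegE big1 // => i _; apply/eqP; apply: contrapT => /negP mi; apply: H.
    by exists i.
  have em' : m = (U_(i) + (m - U_(i)))%MM by rewrite addmC submK // lep1mP.
  rewrite em' mpolyXD; apply: mem_ideal_mul; first by apply: ideal_gen_sub; exists i.
  by apply: IH; move: em; rewrite {1}em' mdegD mdeg1.
rewrite [g]mpolyE big_seq; apply: (ideal_sum _ (idm e)) => m mg.
rewrite -mul_mpolyC; apply: (ideal_mull _ (idm e)); apply: Xm.
by rewrite (dhomog_mf hg mg).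
Qed.

Lemma homog_ideal_gen_degree (G : set R) t e g : (forall x, G x -> exists2 u, (t <= u)%N &
  x \is u.-homog) -> ideal_gen G g -> (e < t)%N -> pihomog mdeg e g = 0.
Proof.
move=> hG Gg; move: g Gg e.
suff : ideal_gen G `<=` [set g : R | forall e, (e < t)%N -> pihomog mdeg e g = 0].
  by move=> H g /H.
apply: ideal_gen_min; first split.
- by move=> e _; rewrite raddf0.
- by move=> x y /= Hx Hy e et; rewrite raddfD /= Hx ?Hy ?addr0.
- move=> r x /= Hx e et.
  rewrite (pihomog_partitionE (leqnn (msize r))) mulr_suml raddf_sum /= big1 // => i _.
  rewrite (pihomogMl _ _ (pihomogP _ _ _)); case: leqP => // _.
  by rewrite Hx ?mulr0 // (leq_ltn_trans (leq_subr _ _)).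
- move=> x Gx e et; have [u tu hx] := hG x Gx; apply: (pihomog_ne0 _ hx).
  by rewrite gtn_eqF // (leq_trans et).
Qed.

Lemma alphaE (J : set R) t : is_alpha J t -> alpha J = t.
Proof.
move=> [[g [Jg g0 hg]] tmin]; apply: xget_unique; first by split => //; exists g.
move=> u [[g' [Jg' g'0 hg']] umin]; apply/eqP; rewrite eqn_leq.
by rewrite (tmin _ _ Jg' g'0 hg') (umin _ _ Jg g0 hg).
Qed.

End Alpha.

(** Positivity gives l (h + m - 1) >= h, so the subtraction of h is not truncated; the right side
    has the form lm + q required by [small_deficits_containment]. *)
Lemma containment_exponent (h k l m : nat) :
  (0 < h)%N -> (0 < k)%N -> (0 < l)%N -> (0 < m)%N ->
  (l * (h + m - 1) - h + k = l * m + ((l - 1) * (h - 1) + k - 1))%N.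
Proof.
case: h l => // h [|l] // _ k0 _ m0; rewrite addSn !subn1 /= mulnDr mulSn.
by have : (0 < l.+1 * m)%N by [rewrite muln_gt0]; lia.
Qed.

(** * Generalized star configuration ideals and their symbolic powers *)

Section StarConfigurations.
Variables (K : fieldType) (n s a b d : nat) (f : 'I_s -> {mpoly K[n]}).
Local Notation R := {mpoly K[n]}.
Local Notation exponent := {ffun 'I_s -> nat}.
Local Notation h := (b * s - a + 1)%N.
Implicit Types (k v w : exponent) (A B : {set 'I_s}) (m : nat).
Hypotheses (b_gt0 : (0 < b)%N) (d_gt0 : (0 < d)%N).
Hypotheses (a_le : (a <= b * s)%N) (h_le_s : (h <= s)%N) (h_lt_n : (h < n)%N).
Hypotheses (homog_f : forall i, f i \is d.-homog) (generic_f : c_generic h f).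

Local Notation I := (a_fold_ideal a b f).
Local Notation symb_exp m := (small_deficits (m * b) (m * (h - 1)) h.+1).
Local Notation J m := (mon_ideal f (symb_exp m)).

Lemma h1E : (h - 1 = b * s - a)%N. Proof. by rewrite addnK. Qed.

Lemma a_fold_mon k : (\sum_i (b - k i) <= h - 1)%N -> I (mon f k).
Proof.
rewrite h1E => /(exponent_truncate a_le)[w [wk wb eS]].
apply: (mem_mon_le (is_ideal_gen _) wk).
by apply: ideal_gen_sub; exists w.
Qed.

(** A generator of I has total deficit bs - a = h - 1. Conversely, for m = 1 the bound on h-sets
    already bounds the total deficit, and the exponent can be truncated to one of sum a. *)
Lemma a_foldE : I = J 1.
Proof.
rewrite !mul1n; apply/seteqP; split.
  apply: ideal_gen_min => [|_ [k [kb ka ->]]]; first exact: is_ideal_mon.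
  have -> : \prod_i f i ^+ k i = mon f [ffun i => k i].
    by apply: eq_bigr => i _; rewrite ffunE.
  apply: mem_mon_ideal => B _; rewrite h1E.
  apply: leq_trans (deficit_sub _ _ (finset.subsetT B)) _.
  have eS : (\sum_(i in finset.setT) (b - [ffun i => k i] i) + \sum_i k i = b * s)%N.
    rewrite (eq_bigl xpredT) => [|i]; last by rewrite inE.
    rewrite -big_split /= (eq_bigr (fun=> b)) => [|i _]; last by rewrite ffunE subnK.
    by rewrite sum_nat_const card_ord mulnC.
  by rewrite /deficit -ka -eS addnK.
apply: (mon_ideal_min (is_ideal_gen _)) => k sk.
apply: a_fold_mon; rewrite subn1; apply: total_deficit h_le_s _; first by rewrite addn1.
by rewrite -subn1.
Qed.

Lemma a_fold_exp_sub m : ideal_exp I m `<=` J m.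
Proof.
elim: m => [|m IH].
  by move=> x _; rewrite level_setT // mul0n muln0.
apply: ideal_gen_min => [|_ [x [y [Ix Iy ->]]]]; first exact: is_ideal_mon.
move: Ix (IH _ Iy); rewrite a_foldE; apply: (ideal_mul_gen (is_ideal_mon _ _)).
move=> _ _ [k sk ->] [v sv ->].
rewrite (_ : _ * _ = mon f [ffun i => k i + v i]%N); last first.
  by rewrite -big_split; apply: eq_bigr => i _; rewrite ffunE exprD.
apply: mem_mon_ideal => B cB.
apply: (@leq_trans (deficit (1 * b) B k + deficit (m * b) B v)); last first.
  by rewrite mulSn leq_add ?sv //; have := sk B cB; rewrite (mul1n (h - 1)%N).
rewrite /deficit -big_split; apply: leq_sum => i _ /=; rewrite ffunE mul1n mulSn; lia.
Qed.

Lemma a_fold_exp_mon m k : (\sum_i (m * b - k i) <= m * (h - 1))%N ->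
  ideal_exp I m (mon f k).
Proof.
elim: m k => [|m IH] k // /exponent_split[k1 [k2 [le12 le1 le2]]].
have idm := is_ideal_exp I m.+1.
apply: (mem_mon_le idm (k := [ffun i => k1 i + k2 i]%N)).
  by move=> i; rewrite ffunE.
rewrite (_ : mon f _ = mon f k1 * mon f k2).
  by apply: mem_ideal_mul; [apply: a_fold_mon|apply: IH].
by rewrite -big_split; apply: eq_bigr => i _; rewrite ffunE exprD.
Qed.

(** The least c with h <= c b: on fewer indices the deficit never exceeds m (h - 1), so there are no
    components of smaller codimension. *)
Definition min_codim : nat := ((h - 1) %/ b).+1.

Lemma min_codim_le : (min_codim <= h)%N.
Proof. by rewrite /min_codim h1E addn1 ltnS leq_div. Qed.
Lemma min_codim_deficit m : (min_codim.-1 * (m * b) <= m * (h - 1))%N.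
Proof. by rewrite mulnCA leq_mul2l leq_divM orbT. Qed.
Lemma min_codim_bound c : (min_codim <= c)%N -> (h <= c * b)%N.
Proof.
move=> cc; apply: (@leq_trans (min_codim * b)%N); last by rewrite leq_mul2r cc orbT.
by rewrite /min_codim h1E addn1 ltn_ceil.
Qed.

Lemma J_filtered m : filtered [set P | exists2 A : {set 'I_s},
  (min_codim <= #|A| <= h)%N & P = var_ideal f A] (J m) setT.
Proof.
apply: (filtered_levels d_gt0 homog_f generic_f) => //.
  exact: min_codim_deficit.
exact: min_codim_le.
Qed.

Lemma J_associated m (y : R) : is_prime (colon (J m) y) ->
  exists A (r : R), (min_codim <= #|A| <= h)%N /\ colon (J m) y = colon (var_ideal f A) r.
Proof.
move=> /(filtered_associated (is_ideal_mon f _) (J_filtered m) Logic.I).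
by move=> [_ [r [[A cA ->] e]]]; exists A, r.
Qed.

Lemma ass_a_fold p : ass I p -> exists2 A : {set 'I_s}, (#|A| <= h)%N & forall i, i \notin A -> ~ p (f i).
Proof.
move=> [pp [y ep]]; move: pp; rewrite ep -/(colon I y) a_foldE => pp.
have [A [r [/andP[_ cA] e]]] := J_associated pp.
exists A => // i iA; rewrite e => /(nzd_var_ideal d_gt0 homog_f generic_f cA iA) vr.
by case: pp => _ + _; apply; rewrite e /colon /= mul1r.
Qed.

(** The f_i with i outside A avoid p, and multiplying by their powers f_i^(mb) reduces the total
    deficit to that on A, which puts the product in I^m. *)
Lemma J_sub_symb_pow m : J m `<=` symb_pow I m.
Proof.
apply: (mon_ideal_min (is_ideal_symb_pow _ _)) => k sk.
apply/symb_powE => p ap; have [A cA nA] := ass_a_fold ap.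
have [[idp p1 pM] _] := ap; exists (\prod_(i | i \notin A) f i ^+ (m * b)).
  apply: (big_ind (fun x => ~ p x)) => // [x y npx npy /pM[]//|i iA].
  elim: (m * b)%N => [|e IH]; first by rewrite expr0.
  by rewrite exprS => /pM[|] //; apply: nA.
pose k' : exponent := [ffun i => k i + (i \notin A) * (m * b)]%N.
rewrite (_ : _ * _ = mon f k'); last first.
  rewrite [X in X * _]big_mkcond -big_split; apply: eq_bigr => i _ /=; rewrite ffunE.
  by case: (i \in A) => /=; rewrite ?mul1r ?mul0n ?addn0 // mul1n addnC exprD.
apply: a_fold_exp_mon; apply: leq_trans (sk A _); last by rewrite ltnS.
rewrite /deficit [X in (_ <= X)%N]big_mkcond /=; apply: leq_sum => i _; rewrite ffunE.
by case: (i \in A); rewrite ?mul0n ?addn0 //= mul1n; lia.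
Qed.

(** The witness has deficit h on A, one too many; raising any of its entries on A brings it into
    I. *)
Lemma var_ideal_ass A : (min_codim <= #|A| <= h)%N ->
  exists v, colon I (mon f v) = var_ideal f A.
Proof.
move=> /andP[cA Ah]; have [|v [dv vA lv]] := @cell_witness s b (h - 1) A.
  by rewrite h1E -addn1 Ah /= min_codim_bound.
exists v; rewrite a_foldE !mul1n.
apply: (colon_mon d_gt0 homog_f generic_f Ah); first exact: is_ideal_mon.
  have sub : mon_ideal f (small_deficits b (h - 1) h.+1) `<=`
      mon_ideal f (small_deficits b (h - 1) #|A|.+1).
    by apply: mon_ideal_sub => k sk B cB; apply: sk; apply: leq_trans cB _.
  apply: subset_trans sub _; apply: level_sub_pow_ideal => //.
  by rewrite dv.
move=> j jA; rewrite -mon_incr; apply: mem_mon_ideal => B _.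
exact: cell_witness_incr dv vA lv jA.
Qed.

(** For x outside J m, some prime J m : rx is a colon of a [var_ideal], itself a colon of I, hence
    is associated to I. A multiplier of x into I^m, which lies in J m, would belong to this
    prime. *)
Lemma symb_pow_sub_J m : (0 < m)%N -> symb_pow I m `<=` J m.
Proof.
move=> m0 x /symb_powE sx; apply: contrapT => nJx.
have idJ := is_ideal_mon f (symb_exp m).
have [r nJrx pr] := exists_associated_prime idJ nJx.
have [A [r' [cA e]]] := J_associated pr.
have [v ev] := var_ideal_ass cA.
have [|t nt It] := sx (colon (J m) (r * x)).
  split => //; exists (r' * mon f v); rewrite e -ev.
  by apply/seteqP; split=> w; rewrite /colon /= -mulrA.
apply: nt; rewrite /colon /= mulrCA; apply: (ideal_mull _ idJ).
exact: a_fold_exp_sub.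
Qed.

Lemma symb_pow_a_fold m : (0 < m)%N -> symb_pow I m = J m.
Proof.
by move=> m0; apply/seteqP; split; [exact: symb_pow_sub_J|exact: J_sub_symb_pow].
Qed.

Lemma symb_pow_seq_cohen_macaulay m : infinite_set [set: K] -> (0 < m)%N ->
  seq_cohen_macaulay (symb_pow I m).
Proof.
move=> infK m0; rewrite symb_pow_a_fold //; set D := (m * (h - 1))%N.
(* This level omits the components of codimension above h - i, so the stratum from i to i + 1 has
   dimension n - (h - i). *)
pose F i := mon_ideal f (small_deficits (m * b) D (h.+1 - i)).
have cle := min_codim_le.
exists (h.+1 - min_codim)%N, F, (fun i => n - (h - i))%N; split.
- rewrite /F subn0 subKn; last by apply: leqW.
  by split => //; apply: level_setT; apply: min_codim_deficit.
- by move=> i _; apply: (homog_mon_ideal homog_f).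
- move=> i _; apply: mon_ideal_sub => k sk B cB; apply: sk; apply: leq_trans cB _.
  exact: leq_sub2l.
- move=> i ilt; pose c := (h - i)%N.
  have ch : (c <= h)%N by apply: leq_subr.
  have cs : (c <= s)%N by apply: leq_trans h_le_s.
  have cc : (min_codim <= c)%N by rewrite /c; lia.
  have -> : F i.+1 = mon_ideal f (small_deficits (m * b) D c) by rewrite /F subSS.
  have -> : F i = mon_ideal f (small_deficits (m * b) D c.+1).
    by rewrite /F subSn //; move: ilt cle; move: min_codim; clear; lia.
  have [A cA _] := @lowest_exists s [ffun=> 0%N] c cs.
  pose T : finType := {A : {set 'I_s} | #|A| == c}.
  pose gs (B : T) := [seq f j | j <- enum (val B)].
  apply: (@filtered_cohen_macaulay K n T gs c) => //.
  + by apply: leq_trans ch _; apply: ltnW.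
  + by move=> B; rewrite size_map -cardE (eqP (valP B)).
  + by move=> B g /mapP[j _ ->]; exists d.
  + by move=> B; apply: (regular_f generic_f); rewrite (eqP (valP B)) leqW.
  + exact: is_ideal_mon.
  + apply: filtered_sub (filtered_level d_gt0 homog_f generic_f _ _ ch cs).
    by move=> _ [B /eqP cB ->]; exists (Sub B cB).
  (* The stratum is nonzero: the witness lies in level c, and it can lie in level c + 1 only if 1
     lies in (f_i, i in A). *)
  have [|v [dv vA lv]] := @cell_witness s (m * b) D A.
    have := min_codim_bound cc; rewrite cA /D => hcb.
    apply/andP; split; first by apply: leq_trans ch _; have := leq_pmull (h - 1) m0; lia.
    have := leq_mul (leqnn m) hcb; rewrite mulnCA.
    have -> : (m * h = m * (h - 1) + m)%N by rewrite -mulnSr h1E addn1.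
    by move: (m * (h - 1))%N => x; lia.
  move=> sub; have dvA : (D < deficit (m * b) A v)%N by rewrite dv.
  have : pow_ideal f A [ffun j => (v j).+1] (mon f v * 1).
    rewrite mulr1; apply: (level_sub_pow_ideal cA dvA); apply: sub.
    apply: mem_mon_ideal => B cB.
    by apply: cell_witness_small dv vA lv _; rewrite cA.
  move=> /(pow_ideal_colon d_gt0 homog_f generic_f); rewrite cA => /(_ ch) v1.
  apply: (@max_ideal1 K n); apply: (ext_min (is_ideal_max K n) _ _ v1).
    by move=> _ ->; apply: (ideal0 (is_ideal_max K n)).
  by move=> _ /mapP[j _ ->]; apply: posform_max; exists d.
- by move=> i; move: min_codim cle; move: h_lt_n; clear; lia.
Qed.

Lemma symb_pow_containment (k l m : nat) : (0 < k)%N -> (0 < l)%N -> (0 < m)%N ->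
  symb_pow I (l * (h + m - 1) - h + k) `<=`
  ideal_mul (ideal_exp (max_ideal K n)
      (d * ((l - 1) * (h - 1) + k - 1) * (b * h - (b * s - a))))
    (ideal_exp (symb_pow I m) l).
Proof.
move=> k0 l0 m0; set q := ((l - 1) * (h - 1) + k - 1)%N.
have -> : (l * (h + m - 1) - h + k = l * m + q)%N by apply: containment_exponent; rewrite ?addn1.
rewrite !symb_pow_a_fold //; last by rewrite addn_gt0 muln_gt0 l0 m0.
apply: (mon_ideal_min (is_ideal_gen _)) => v sv.
have h0 : (0 < h)%N by rewrite addn1.
have [|w [sw wv le]] := small_deficits_containment h_le_s h0 b_gt0 m0 l0 _ sv.
  by rewrite /q; lia.
have -> : mon f v = mon f [ffun i => v i - l * w i]%N * mon f w ^+ l.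
  rewrite -[X in _ * X ^+ _]/(\prod_i f i ^+ w i) -prodrXl -big_split; apply: eq_bigr => i _ /=.
  by rewrite ffunE -exprM (mulnC (w i)) -exprD subnK.
apply: mem_ideal_mul; last by apply: mem_ideal_expX; apply: mem_mon_ideal.
apply: homog_mem_max_exp (mon_homog homog_f _) _.
rewrite h1E in le; rewrite -mulnA leq_mul2l; apply/orP; right; apply: leq_trans le _.
by apply: leq_sum => i _; rewrite ffunE.
Qed.

(** The case of the empty set in [nzd_var_ideal] makes each f_i a nonzerodivisor of R. *)
Lemma mon_neq0 k : mon f k != 0.
Proof.
apply/prodf_neq0 => i _; rewrite expf_neq0 //; apply/eqP => fi0.
have : nzd (var_ideal f finset.set0) (f i).
  by apply: (nzd_var_ideal d_gt0 homog_f generic_f); rewrite ?cards0 ?inE.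
rewrite fi0 => /(_ 1); rewrite /var_ideal enum_set0 /= mul0r => /(_ erefl) /eqP.
by rewrite oner_eq0.
Qed.

Lemma alpha_symb_pow m : (0 < m)%N -> exists2 k : exponent, symb_exp m k &
  alpha (symb_pow I m) = (d * \sum_i k i)%N /\
  forall v, symb_exp m v -> (\sum_i k i <= \sum_i v i)%N.
Proof.
move=> m0; rewrite symb_pow_a_fold //.
have ex : exists t, `[< exists2 k : exponent, symb_exp m k & (\sum_i k i)%N = t >].
  exists (\sum_(i < s) [ffun=> m * b]%N i)%N; apply/asboolP; exists [ffun=> m * b]%N => //.
  by move=> B _; rewrite /deficit big1 // => i _; rewrite ffunE subnn.
case: (ex_minnP ex) => t /asboolP[k sk ek] tmin; exists k => //.
have kmin v : symb_exp m v -> (\sum_i k i <= \sum_i v i)%N.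
  by move=> sv; rewrite ek; apply: tmin; apply/asboolP; exists v.
split => //; apply: alphaE; split.
  exists (mon f k); split; [exact: mem_mon_ideal|exact: mon_neq0|exact: mon_homog].
move=> t' g Jg g0 hg; rewrite leqNgt; apply/negP => lt.
move/eqP: g0; apply; rewrite -(pihomog_dE hg).
apply: (homog_ideal_gen_degree _ Jg lt) => _ [v sv ->].
exists (d * \sum_i v i)%N; last exact: mon_homog.
by rewrite leq_mul2l kmin ?orbT.
Qed.

(** The multiple N k is decomposed, with q = l (h - 1): then lm + q = l N, for which N k is
    admissible, and the surplus q (bh - (h - 1)) is at least l (h - 1). *)
Lemma alpha_symb_pow_le l m : (0 < l)%N -> (0 < m)%N ->
  (l * (alpha (symb_pow I m) + (h - 1)) <= alpha (symb_pow I l) * (m + (h - 1)))%N.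
Proof.
move=> l0 m0; have [k sk [-> _]] := alpha_symb_pow l0.
have [v sv [-> vmin]] := alpha_symb_pow m0.
set N := (m + (h - 1))%N.
have h0 : (0 < h)%N by rewrite addn1.
have [||w [sw wk le]] := @small_deficits_containment s b h m l (l * (h - 1))
  [ffun i => N * k i]%N h_le_s h0 b_gt0 m0 l0.
- by rewrite leq_mul2r; apply/orP; right; lia.
- rewrite -mulnDr -/N => B cB; rewrite [X in (_ <= X)%N]mulnAC.
  apply: leq_trans (leq_mul (sk B cB) (leqnn N)).
  rewrite /deficit [X in (_ <= X)%N]big_distrl /=; apply: leq_sum => i _.
  by rewrite ffunE mulnBl mulnAC (mulnC N).
have eS : (\sum_i (N * k i - l * w i) + l * \sum_i w i = N * \sum_i k i)%N.
  rewrite !big_distrr /= -big_split /=; apply: eq_bigr => i _.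
  by have := wk i; rewrite ffunE => /subnK.
have {}le : (l * (h - 1) <= \sum_i (N * k i - l * w i))%N.
  apply: leq_trans (_ : l * (h - 1) * (b * h - (h - 1)) <= _)%N.
    by rewrite leq_pmulr // subn_gt0; have := leq_pmull h b_gt0; lia.
  by apply: leq_trans le _; apply: leq_sum => i _; rewrite ffunE.
have := vmin w sw; rewrite mulnAC -mulnA -eS mulnDr mulnDr.
move: (\sum_i (N * k i - _))%N (\sum_i w i)%N (\sum_i v i)%N le => x y z le zy.
(* The degree d multiplies the surplus and can only enlarge it. *)
rewrite addnC leq_add //; first by apply: leq_trans le _; rewrite leq_pmull.
by rewrite mulnCA leq_mul2l leq_mul2l zy !orbT.
Qed.

End StarConfigurations.

Theorem theorem1p1 (K : fieldType) (n s a b d : nat)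
    (f : 'I_s -> {mpoly K[n.+1]}) :
  let h := (b * s - a + 1)%N in
  let mm := max_ideal K n.+1 in
  let I := a_fold_ideal a b f in
  infinite_set [set: K] ->
  (n + 1 <= s)%N ->
  (0 < a)%N -> (0 < b)%N -> (0 < d)%N ->
  ((b - 1) * s + 1 < a)%N -> (a <= b * s)%N ->
  (b * s - a + 1 <= n)%N ->
  (forall i, f i \is d.-homog) ->
  c_generic (b * s - a + 1) f ->
  [/\ (forall m : nat, (0 < m)%N -> seq_cohen_macaulay (symb_pow I m)),
      (forall k l m : nat, (0 < k)%N -> (0 < l)%N -> (0 < m)%N ->
         symb_pow I (l * (h + m - 1) - h + k)%N `<=`
         ideal_mul
           (ideal_exp mm
              (d * ((l - 1) * (h - 1) + k - 1) * (b * h - (b * s - a)))%N)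
           (ideal_exp (symb_pow I m) l))
    & (forall l m : nat, (0 < l)%N -> (0 < m)%N ->
         ((alpha (symb_pow I m))%:R + h%:R - 1) / (m%:R + h%:R - 1)
           <= (alpha (symb_pow I l))%:R / l%:R :> rat)].
Proof.
move=> h mm I infK ns _ b0 d0 _ ab hn homf genf.
have hs : (h <= s)%N by apply: leq_trans hn _; apply: leq_trans ns; rewrite leq_addr.
have hn1 : (h < n.+1)%N by rewrite ltnS.
split.
- by move=> m m0; apply: (symb_pow_seq_cohen_macaulay b0 d0 ab hs hn1 homf genf).
- by move=> k l m; apply: (symb_pow_containment b0 d0 ab hs hn1 homf genf).
move=> l m l0 m0; have := alpha_symb_pow_le b0 d0 ab hs hn1 homf genf l0 m0.
rewrite -/I addnK => le.
(* Writing h - 1 as a natural number reduces the fractions to the inequality in [nat]. *)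
have hE : h%:R = (b * s - a)%:R + 1 :> rat by rewrite /h natrD.
rewrite hE !addrA !addrK -!natrD ler_pdivrMr ?ltr0n ?addn_gt0 ?m0 //.
by rewrite mulrAC ler_pdivlMr ?ltr0n // -!natrM ler_nat mulnC.
Qed.
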